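(* For every $\varepsilon\in(0,1)$ the limit $M(\varepsilon\mid\mathrm{MonoReg})=\lim_{N\to\infty}M(\mathcal F_{N,\varepsilon,\mathrm{mono}}\mid\eta^{mono})$ exists and $$M(\varepsilon\mid\mathrm{MonoReg})=\max\Big\{\varepsilon\sum_{\ell\ge1}\pi_\ell\,r(\ell)\;:\;\pi\text{ a probability distribution on }\{1,2,\dots\},\ \sum_{\ell\ge1}\ell\,\pi_\ell=1/\varepsilon\Big\}.$$ Equivalently, $M(\varepsilon\mid\mathrm{MonoReg})/\varepsilon=\hat r(1/\varepsilon)$, where $\hat r$ is the least concave majorant on $[1,\infty)$ of the point set $\{(\ell,r(\ell)):\ell\in\mathbb N\}$. Furthermore, there exists $\varepsilon_0>0$ such that $M(\varepsilon\mid\mathrm{MonoReg})\le20\,\varepsilon\,(\log(1/\varepsilon))^2$ for all $\varepsilon\in(0,\varepsilon_0]$.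
   Context: $\mathcal M_N=\{x\in\mathbb R^N:x_{t+1}\ge x_t\ \forall t\le N-1\}$; $\eta^{mono}(y)=\arg\min_{x\in\mathcal M_N}\|y-x\|_2^2$; $r(\ell)=\mathbb E\|\eta^{mono}(\mathbf Z)\|_2^2$ with $\mathbf Z\sim\mathsf N(0,I_{\ell\times\ell})$. The class of mostly-constant nondecreasing signals is $$\mathcal F_{N,\varepsilon,\mathrm{mono}}=\{\nu_N\in\mathcal P(\mathbb R^N):\mathrm{supp}(\nu_N)\subseteq\mathcal M_N,\ \mathbb E_{\nu_N}[\#\{t\in\{1,\dots,N-1\}:X_{t+1}>X_t\}]\le N\varepsilon\},$$ and $M(\mathcal F_{N,\varepsilon,\mathrm{mono}}\mid\eta^{mono})=\frac1N\sup_{\nu_N\in\mathcal F_{N,\varepsilon,\mathrm{mono}}}\mathbb E_{\nu_N}\|\mathbf X-\eta^{mono}(\mathbf X+\mathbf Z)\|_2^2$, with $\mathbf X\sim\nu_N$ independent of $\mathbf Z\sim\mathsf N(0,I_{N\times N})$. *)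

(* Defs.v *)
From HB Require Import structures.
From mathcomp Require Import all_boot all_order all_algebra.
From mathcomp Require Import all_classical all_reals all_analysis.
Set Implicit Arguments. Unset Strict Implicit. Unset Printing Implicit Defensive.
Import Order.TTheory GRing.Theory Num.Theory.
Import numFieldNormedType.Exports.
Local Open Scope classical_set_scope.
Local Open Scope ring_scope.

Section MonoReg.
Variable R : realType.

(* R^N is represented as N.-tuple R, with the product sigma-algebra
   (measure_tuple_display) provided by MathComp-Analysis. *)

Definition sqdist (N : nat) (x y : N.-tuple R) : R :=
  \sum_(i < N) (tnth x i - tnth y i) ^+ 2.

Definition tadd (N : nat) (x y : N.-tuple R) : N.-tuple R :=
  [tuple tnth x i + tnth y i | i < N].

Definition monoset (N : nat) : set (N.-tuple R) :=
  [set x | forall t : nat, (t.+1 < N)%N -> nth 0 x t <= nth 0 x t.+1].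

(* isotonic regression: the (unique) minimiser of ||y - x||_2^2 over M_N,
   chosen by Hilbert's epsilon (default y, never used since it exists) *)
Definition eta_mono (N : nat) (y : N.-tuple R) : N.-tuple R :=
  xget y [set x | @monoset N x /\
                  forall x', @monoset N x' -> sqdist y x <= sqdist y x'].

(* E f(Z) for Z ~ N(0, I_{n x n}) and f >= 0, as the iterated (Tonelli)
   integral against the standard normal law in each coordinate. *)
Fixpoint gaussE (n : nat) : (n.-tuple R -> \bar R) -> \bar R :=
  match n with
  | 0 => fun f => f [tuple]
  | n'.+1 => fun f =>
      (\int[normal_prob (0:R) 1]_z gaussE (fun t : n'.-tuple R => f [tuple of z :: t]))%E
  end.

Definition rmono (l : nat) : \bar R :=
  gaussE (fun z : l.-tuple R => (sqdist (eta_mono z) (nseq_tuple l 0))%:E).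

Definition njumps (N : nat) (x : N.-tuple R) : nat :=
  count (fun t => nth 0 x t < nth 0 x t.+1) (iota 0 N.-1).

Definition risk (N : nat) (nu : probability (N.-tuple R) R) : \bar R :=
  (\int[nu]_x gaussE (fun z : N.-tuple R => (sqdist x (eta_mono (tadd x z)))%:E))%E.

Definition Mmono (N : nat) (eps : R) : \bar R :=
  ((N%:R)^-1%:E * ereal_sup [set v | exists nu : probability (N.-tuple R) R,
      nu (~` @monoset N) = 0%E /\
      (\int[nu]_x ((njumps x)%:R)%:E <= (N%:R * eps)%:E)%E /\
      v = risk nu])%E.

Definition feasible_pi (eps : R) (pi : nat -> R) : Prop :=
  pi 0%N = 0 /\ (forall l, 0 <= pi l) /\
  (\sum_(1 <= l <oo) (pi l)%:E = 1%:E)%E /\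
  (\sum_(1 <= l <oo) (l%:R * pi l)%:E = (eps^-1)%:E)%E.

Definition pi_value (eps : R) (pi : nat -> R) : \bar R :=
  (eps%:E * \sum_(1 <= l <oo) ((pi l)%:E * rmono l))%E.

Definition concave_on_ge1 (g : R -> R) : Prop :=
  forall x y t, 1 <= x -> 1 <= y -> 0 <= t <= 1 ->
    t * g x + (1 - t) * g y <= g (t * x + (1 - t) * y).

Definition rhat (x : R) : \bar R :=
  ereal_inf [set (g x)%:E | g in [set g : R -> R | concave_on_ge1 g /\
      forall l : nat, (1 <= l)%N -> (rmono l <= (g l%:R)%:E)%E]].

End MonoReg.

(* Main.v *)
(* The null risk r(l) is the harmonic number H_l. Write x for the isotonic regression
   of z; for every level s, the largest of the partial sums (from the left) of s - z
   equals sum_t max(s - x_t, 0). When the total sum of s - z is positive this maximum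
   is s - z_0 plus the maximum for z without its first entry, otherwise it is the
   maximum for z without its last entry; summing over the n rotations of z and letting
   s vary, the multiset of fitted values over all rotations of z is that obtained after
   deleting the last entry of each rotation, together with n copies of the mean of z.
   Taking squares and expectations, r(n) = r(n - 1) + 1/n.

   For a monotone x with J jumps, |eta(x + z) - x|^2 is at most the sum over the J + 1
   constancy blocks of x of the squared norms of the regressions of z on the blocks,
   with equality in the limit of infinitely high jumps. Hence the risk at x is at most
   sum_b H_(l_b), approached by staircases. Since H is concave, the chord of H between
   n and n + 1, where n = floor(1/eps), is a supporting line at 1/eps, and it bounds the
   worst-case risk; K = floor(N eps) balanced blocks attain it up to O(1/N). *)
Require Import Defs.
From HB Require Import structures.
From mathcomp Require Import all_boot all_order all_algebra.
From mathcomp Require Import all_classical all_reals all_analysis.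
From mathcomp Require Import measurable_realfun ring lra zify.
Set Implicit Arguments. Unset Strict Implicit. Unset Printing Implicit Defensive.
Import Order.TTheory GRing.Theory Num.Theory.
Import numFieldNormedType.Exports.
Local Open Scope classical_set_scope.
Local Open Scope ring_scope.

(** * Isotonic regression and rotations *)

Section IsotonicRegression.
Variable R : realType.
Implicit Types (n m k t : nat) (x y z v w : nat -> R) (s : R).

Definition psum z k : R := \sum_(i < k) z i.

Definition shift m z : nat -> R := fun i => z (m + i)%N.

Definition monof n x := forall t, (t.+1 < n)%N -> x t <= x t.+1.

(* The optimality conditions of the projection of [z] onto the monotone cone, read on
   partial sums through Abel summation. *)
Definition isoreg n z x :=
  [/\ monof n x,
      forall k, (k <= n)%N -> psum x k <= psum z k,
      psum x n = psum z n &
      forall t, (t.+1 < n)%N -> x t < x t.+1 -> psum x t.+1 = psum z t.+1].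

Lemma psum0 z : psum z 0 = 0. Proof. by rewrite /psum big_ord0. Qed.

Lemma psumS z k : psum z k.+1 = psum z k + z k.
Proof. by rewrite /psum big_ord_recr. Qed.

Lemma psum_eq x y k : (forall i, (i < k)%N -> x i = y i) -> psum x k = psum y k.
Proof. by move=> h; apply: eq_bigr => i _; exact: h. Qed.

Lemma psumD z m k : psum z (m + k) = psum z m + psum (shift m z) k.
Proof.
elim: k => [|k ih]; first by rewrite addn0 psum0 addr0.
by rewrite addnS !psumS ih addrA.
Qed.

Lemma psum_head z k : psum z k.+1 = z 0%N + psum (shift 1 z) k.
Proof. by rewrite -add1n psumD psumS psum0 add0r. Qed.

Lemma monof_le n x i j : monof n x -> (i <= j)%N -> (j < n)%N -> x i <= x j.
Proof.
move=> mx; elim: j => [|j ih]; first by rewrite leqn0 => /eqP ->.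
rewrite leq_eqVlt => /orP[/eqP -> //|ij] jn.
by rewrite (le_trans (ih _ _)) ?mx //; exact: ltnW.
Qed.

(* Greedy construction: the first block is a prefix of smallest average. *)
Lemma isoreg_exists n z : exists x, isoreg n z x /\
  ((0 < n)%N -> exists k, [/\ (0 < k)%N, (k <= n)%N & psum z k = k%:R * x 0%N]).
Proof.
elim/ltn_ind: n z => -[_ z|n ih z].
  exists z; split=> //; split=> // [t|t]; by rewrite ltn0.
pose avg (i : 'I_n.+1) := psum z i.+1 / i.+1%:R.
(* [avg i] averages the prefix of length [i.+1], so [m] is the last position of the first block,
   whose length is [m.+1]. *)
pose m := [arg min_(i < ord0) avg i]%O.
have hm (i : 'I_n.+1) : avg m <= avg i.
  by rewrite /m; case: arg_minP => // j _; exact.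
set s := avg m.
have zm : psum z m.+1 = m.+1%:R * s by rewrite /s /avg mulrC divfK ?pnatr_eq0.
have hs k : (k <= n.+1)%N -> k%:R * s <= psum z k.
  case: k => [_|k kn]; first by rewrite mul0r psum0.
  have := hm (Ordinal kn); rewrite -/s /avg /= ler_pdivlMr ?ltr0Sn //.
  by rewrite mulrC.
have [x' [[mx' le' eq' kk'] x'0]] := ih (n - m)%N
  ltac:(by rewrite ltnS leq_subr) (shift m.+1 z).
pose x i := if (i <= m)%N then s else x' (i - m.+1)%N.
have mn : (m <= n)%N by rewrite -ltnS.
have x1 k : (k <= m.+1)%N -> psum x k = k%:R * s.
  move=> km; rewrite (@psum_eq _ (fun=> s)) ?/psum ?sumr_const ?card_ord ?mulr_natl//.
  by move=> i ik; rewrite /x -ltnS (leq_trans ik).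
have shx i : shift m.+1 x i = x' i.
  by rewrite /shift /x addSn leqNgt ltnS leq_addr /= subSS addKn.
have x2 k : psum x (m.+1 + k) = psum z m.+1 + psum x' k.
  by rewrite psumD x1 // zm; congr (_ + _); apply: psum_eq => i _.
(* The second conjunct of the statement serves here: the first value of the tail is the average of a
   prefix of the tail. If it were below [s], joining that prefix to the first block would give an
   average below the minimum. *)
have sx' : (0 < n - m)%N -> s <= x' 0%N.
  move=> nm; have [k [k0 kn kE]] := x'0 nm.
  have : (m.+1 + k)%:R * s <= psum z (m.+1 + k) by apply: hs; lia.
  by rewrite psumD zm kE natrD mulrDl lerD2l ler_pM2l ?ltr0n.
exists x; split; last by move=> _; exists m.+1; split=> //; rewrite zm /x.
split.
- move=> t tn; rewrite /x; case: (ltngtP t m) => tm.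
  + by rewrite lexx.
  + by rewrite subSn //; apply: mx'; lia.
  + rewrite tm subnn; apply: sx'; lia.
- move=> k kn; case: (leqP k m.+1) => km; first by rewrite x1 ?hs.
  by rewrite -(subnKC (ltnW km)) x2 psumD lerD2l le' //; lia.
- have -> : n.+1 = (m.+1 + (n - m))%N by lia.
  by rewrite x2 psumD eq'.
- move=> t tn; rewrite {1 2}/x; case: (ltngtP t m) => tm.
  + by rewrite ltxx.
  + rewrite subSn // => lt.
    have -> : t.+1 = (m.+1 + (t - m.+1).+1)%N by lia.
    by rewrite x2 psumD kk' //; lia.
  + by move=> _; rewrite tm x1 // zm.
Qed.

(** Summation by parts. For monotone [v] the increments are nonnegative weights, so sign conditions
    on partial sums of [d] pass to the dot product. *)
Lemma abel n (d v : nat -> R) : \sum_(i < n.+1) d i * v i =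
  psum d n.+1 * v n - \sum_(i < n) psum d i.+1 * (v i.+1 - v i).
Proof.
elim: n => [|n ih]; first by rewrite big_ord1 big_ord0 psumS psum0 add0r subr0.
rewrite big_ord_recr /= ih [in RHS]big_ord_recr /= (psumS _ n.+1); ring.
Qed.

Lemma psumB x y k : psum (fun i => x i - y i) k = psum x k - psum y k.
Proof. by rewrite /psum sumrB. Qed.

(** The residual lies in the polar of the monotone cone: the boundary term vanishes because the
    totals agree, and every other term has a sign. *)
Lemma isoreg_dot n z x v : isoreg n z x -> monof n v ->
  \sum_(i < n) (z i - x i) * v i <= 0.
Proof.
case: n => [|n] [_ le eq _] mv; first by rewrite big_ord0.
rewrite (abel n (fun i => z i - x i)) psumB eq subrr mul0r sub0r oppr_le0.
apply: sumr_ge0 => i _; by rewrite psumB mulr_ge0 // subr_ge0 ?le ?mv // ltnS // ltnW.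
Qed.

(** Complementary slackness: at each index either [x] has no increment or the partial sums of [x]
    and [z] meet. *)
Lemma isoreg_dot0 n z x : isoreg n z x -> \sum_(i < n) (z i - x i) * x i = 0.
Proof.
case: n => [|n] [mx le eq kk]; first by rewrite big_ord0.
rewrite (abel n (fun i => z i - x i)) psumB eq subrr mul0r sub0r.
rewrite big1 ?oppr0 // => i _; rewrite psumB.
have := mx i; rewrite ltnS ltn_ord le_eqVlt => /(_ isT) /orP[/eqP ->|lt].
  by rewrite subrr mulr0.
by rewrite kk ?subrr ?mul0r // ltnS.
Qed.

(** The cross term in the expanded square is nonnegative by the two previous lemmas. This yields
    both minimality of [x] and its uniqueness. *)
Lemma isoreg_pythagoras n z x v : isoreg n z x -> monof n v ->
  \sum_(i < n) (z i - x i) ^+ 2 + \sum_(i < n) (x i - v i) ^+ 2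
    <= \sum_(i < n) (z i - v i) ^+ 2.
Proof.
move=> ix mv; have := isoreg_dot ix mv; have := isoreg_dot0 ix.
have -> : \sum_(i < n) (z i - v i) ^+ 2 = \sum_(i < n) (z i - x i) ^+ 2 +
    \sum_(i < n) (x i - v i) ^+ 2 + 2 * (\sum_(i < n) (z i - x i) * x i -
    \sum_(i < n) (z i - x i) * v i).
  rewrite -sumrB mulr_sumr -!big_split /=; apply: eq_bigr => i _; ring.
lra.
Qed.

Lemma sum_sqr_eq0 n (a : nat -> R) : \sum_(i < n) a i ^+ 2 <= 0 ->
  forall i, (i < n)%N -> a i = 0.
Proof.
move=> h i iln.
have : \sum_(j < n) a j ^+ 2 == 0.
  by rewrite eq_le h sumr_ge0 // => j _; exact: sqr_ge0.
rewrite psumr_eq0; last by move=> j _; exact: sqr_ge0.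
move=> /allP /(_ (Ordinal iln) (mem_index_enum _)) /=.
by rewrite sqrf_eq0 => /eqP.
Qed.

(** Testing each residual against both fits shows that the difference of residuals has nonnegative
    dot product with the difference of fits. Measurability of [eta_mono] rests on this. *)
Lemma isoreg_nonexpansive n z x z' x' : isoreg n z x -> isoreg n z' x' ->
  \sum_(i < n) (x i - x' i) ^+ 2 <= \sum_(i < n) (z i - z' i) ^+ 2.
Proof.
move=> ix ix'; have [mx _ _ _] := ix; have [mx' _ _ _] := ix'.
have := isoreg_dot ix mx'; have := isoreg_dot0 ix.
have := isoreg_dot ix' mx; have := isoreg_dot0 ix'.
have : 0 <= \sum_(i < n) ((z i - z' i) - (x i - x' i)) ^+ 2.
  by apply: sumr_ge0 => i _; exact: sqr_ge0.
have -> : \sum_(i < n) ((z i - z' i) - (x i - x' i)) ^+ 2 =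
  \sum_(i < n) (z i - z' i) ^+ 2 - \sum_(i < n) (x i - x' i) ^+ 2
  - 2 * (\sum_(i < n) (z i - x i) * x i - \sum_(i < n) (z i - x i) * x' i
    + \sum_(i < n) (z' i - x' i) * x' i - \sum_(i < n) (z' i - x' i) * x i).
  rewrite -!sumrB -big_split -sumrB /= mulr_sumr -sumrB /=.
  apply: eq_bigr => i _; ring.
lra.
Qed.

Lemma isoreg_ext n z z' x x' : (forall i, (i < n)%N -> z i = z' i) ->
  (forall i, (i < n)%N -> x i = x' i) -> isoreg n z x -> isoreg n z' x'.
Proof.
move=> ez ex [mx le eq kk].
have pz k : (k <= n)%N -> psum z k = psum z' k.
  by move=> kn; apply: psum_eq => i ik; apply: ez; exact: leq_trans kn.
have px k : (k <= n)%N -> psum x k = psum x' k.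
  by move=> kn; apply: psum_eq => i ik; apply: ex; exact: leq_trans kn.
split.
- by move=> t tn; rewrite -!ex // ?mx //; exact: ltnW.
- by move=> k kn; rewrite -pz -?px ?le.
- by rewrite -pz -?px ?eq.
- move=> t tn; rewrite -!ex //; last exact: ltnW.
  by move=> lt; rewrite -pz -?px ?kk //; exact: ltnW.
Qed.

(** Polarity replaces [z] by [x] in the dot product with [u]; then the square of [x - u] is
    expanded. *)
Lemma isoreg_dot_le n z x u : isoreg n z x -> monof n u ->
  2 * \sum_(i < n) z i * u i <=
    \sum_(i < n) x i ^+ 2 + \sum_(i < n) u i ^+ 2.
Proof.
move=> ix mu; have := isoreg_dot ix mu.
have : 0 <= \sum_(i < n) (x i - u i) ^+ 2.
  by apply: sumr_ge0 => i _; exact: sqr_ge0.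
have -> : \sum_(i < n) (x i - u i) ^+ 2 = \sum_(i < n) x i ^+ 2 +
  \sum_(i < n) u i ^+ 2 + 2 * (\sum_(i < n) (z i - x i) * u i
   - \sum_(i < n) z i * u i).
  rewrite -sumrB mulr_sumr -!big_split /=; apply: eq_bigr => i _; ring.
lra.
Qed.

(** * Maximal partial sums and cyclic rotations *)

Fixpoint maxpsum n w : R :=
  if n is n'.+1 then Num.max (maxpsum n' w) (psum w n) else 0.

(** The definition peels off the last entry; this recursion peels off the first, the 0 standing for
    the empty prefix. *)
Lemma maxpsum_head n w :
  maxpsum n.+1 w = Num.max 0 (w 0%N + maxpsum n (shift 1 w)).
Proof.
elim: n => [|n ih]; first by rewrite /= psum_head psum0.
rewrite [LHS]/= -/(maxpsum n.+1 w) ih psum_head -maxA [in RHS]/=.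
by rewrite addr_maxr.
Qed.

Lemma maxpsum_eq n w w' : (forall i, (i < n)%N -> w i = w' i) ->
  maxpsum n w = maxpsum n w'.
Proof.
elim: n => //= n ih h; rewrite ih; last by move=> i ?; apply: h; exact: ltnW.
by rewrite (psum_eq h).
Qed.

Lemma maxpsum_ge k n w : (k <= n)%N -> psum w k <= maxpsum n w.
Proof.
elim: n => [|n ih]; first by rewrite leqn0 => /eqP ->; rewrite psum0.
rewrite leq_eqVlt => /orP[/eqP ->|kn] /=; rewrite le_max ?lexx ?orbT //.
by rewrite ih.
Qed.

Lemma maxpsum_le n w s : (forall k, (k <= n)%N -> psum w k <= s) ->
  maxpsum n w <= s.
Proof.
elim: n => [|n ih] h /=; first by rewrite -(psum0 w) h.
by rewrite ge_max h // ih // => k kn; apply: h; exact: ltnW.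
Qed.

(* Both sides are the Legendre transform at [s] of the greatest convex minorant
   of the partial sums of [z]. *)
Lemma isoreg_hinge n z x s : isoreg n z x ->
  maxpsum n (fun i => s - z i) = \sum_(i < n) Num.max (s - x i) 0.
Proof.
move=> [mx le eq kk]; apply/eqP; rewrite eq_le; apply/andP; split.
  apply: maxpsum_le => k kn.
  have : psum (fun i => s - z i) k <= psum (fun i => s - x i) k.
    by rewrite !psumB lerD2l lerN2 le.
  move/le_trans; apply; rewrite -(subnKC kn) big_split_ord /=.
  rewrite -[leLHS]addr0 lerD //.
    by apply: ler_sum => i _; rewrite le_max lexx.
  by apply: sumr_ge0 => i _; rewrite le_max lexx orbT.
(* The maximum is attained at the first index [m] where [x] reaches [s], or at [n] if there is none.
   At an interior [m] the fit jumps strictly across [s], hence the partial sums of [x] and [z] meet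
   there. *)
have ex : exists m, (m == n) || (s <= x m) && (m < n)%N by exists n; rewrite eqxx.
case: (ex_minnP ex) => m hm mmin.
have mn : (m <= n)%N by case/orP: hm => [/eqP ->|/andP[_ /ltnW]].
have lt i : (i < m)%N -> x i < s.
  move=> im; rewrite ltNge; apply/negP => si.
  by have := mmin i; rewrite si (leq_trans im) // orbT leqNgt im => /(_ isT).
have ge i : (m <= i)%N -> (i < n)%N -> s <= x i.
  case/orP: hm => [/eqP ->|/andP[sm _]]; first by rewrite leqNgt => /negP.
  by move=> mi iln; rewrite (le_trans sm) // (monof_le mx).
have E : psum x m = psum z m.
  case: m hm mn lt ge {mmin} => [|m] hm mn lt ge; first by rewrite !psum0.
  move: mn; rewrite leq_eqVlt => /orP[/eqP -> //|mn].
  by apply: kk => //; rewrite (lt_le_trans (lt _ _)) // ge.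
apply: le_trans (maxpsum_ge (k := m) _ mn).
rewrite psumB -E -psumB -(subnKC mn) big_split_ord /=.
rewrite [X in _ + X <= _]big1 ?addr0.
  by apply: ler_sum => i _; rewrite ge_max lexx subr_ge0 ltW ?lt.
move=> i _; apply/max_idPr; rewrite subr_le0 ge ?leq_addr //.
by rewrite -ltn_subRL.
Qed.

Definition rotf n j z : nat -> R := fun i => z ((i + j) %% n)%N.

Lemma psum_rotf n j z : psum (rotf n j z) n = psum z n.
Proof.
elim: j => [|j ih].
  by apply: psum_eq => i iln; rewrite /rotf addn0 modn_small.
rewrite -ih; case: n {ih} => [|n]; first by rewrite !psum0.
rewrite psumS psum_head addrC; congr (_ + _).
  by rewrite /rotf addnS -addSn -modnDml modnn.
by apply: psum_eq => i _; rewrite /rotf /shift addnS add1n.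
Qed.

(** All rotations share the same total. If it is nonpositive, the full sum never beats the empty
    prefix, so the last entry is irrelevant to the maximum. *)
Lemma maxpsum_rotations n w :
  \sum_(j < n.+1) maxpsum n.+1 (rotf n.+1 j w) =
  \sum_(j < n.+1) maxpsum n (rotf n.+1 j w) + Num.max (psum w n.+1) 0.
Proof.
have [T0|T0] := leP (psum w n.+1) 0.
  rewrite addr0; apply: eq_bigr => j _ /=; apply/max_idPl.
  by rewrite psum_rotf (le_trans T0) // -(psum0 (rotf n.+1 j w)) maxpsum_ge.
(* If the total is positive, the empty prefix never wins and the first entry splits off. Summed over
   [j], these entries give the total, and rotation by [n.+1] is rotation by 0. *)
have step (j : 'I_n.+1) : maxpsum n.+1 (rotf n.+1 j w) =
    w j + maxpsum n (rotf n.+1 j.+1 w).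
  have e0 : rotf n.+1 j w 0 = w j by rewrite /rotf add0n modn_small.
  have e1 : shift 1 (rotf n.+1 j w) = rotf n.+1 j.+1 w.
    by apply/funext => i; rewrite /rotf /shift addnS.
  rewrite maxpsum_head e0 e1; apply/max_idPr.
  rewrite (le_trans (ltW T0)) // -(psum_rotf n.+1 j) psum_head e0 e1 lerD2l.
  exact: maxpsum_ge.
rewrite (eq_bigr _ (fun j _ => step j)) big_split /= addrC; congr (_ + _).
rewrite big_ord_recr [in RHS]big_ord_recl /= addrC; congr (_ + _).
apply: maxpsum_eq => i _; congr w; by rewrite addn0 modnDr.
Qed.

Lemma sum_max_gt0 (A : seq R) s a : a \in A -> a < s ->
  0 < \sum_(b <- A) Num.max (s - b) 0.
Proof.
move=> aA sa; rewrite (perm_big _ (perm_to_rem aA)) big_cons /=.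
rewrite ltr_pwDl ?sumr_ge0 ?lt_max ?subr_gt0 ?sa// => b _.
by rewrite le_max lexx orbT.
Qed.

(** The hinge sum at [s] is positive exactly when some entry lies below [s], so it determines the
    minimum; the minimum is removed from both sides and the argument repeats. *)
Lemma perm_eq_of_hinge (A B : seq R) :
  (forall s, \sum_(a <- A) Num.max (s - a) 0 = \sum_(b <- B) Num.max (s - b) 0) ->
  perm_eq A B.
Proof.
have [n] := ubnP (size A); elim: n A B => // n ih [|a0 A] B.
  move=> _; case: B => [//|b B] /(_ (b + 1)); rewrite big_nil => h.
  suff : 0 < 0 :> R by rewrite ltxx.
  by rewrite [ltRHS]h (@sum_max_gt0 _ _ b) ?mem_head // ltrDl.
set A' := a0 :: A => sA h.
have sB : B != [::].
  apply/eqP => B0; have := h (a0 + 1); rewrite B0 big_nil => h0.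
  have := @sum_max_gt0 A' (a0 + 1) a0 (mem_head _ _).
  by rewrite h0 ltxx ltrDl => /(_ ltr01).
have mins (C : seq R) : C != [::] -> exists2 c, c \in C & all (>= c) C.
  elim: C => // c C ihC _; have [->|/ihC [d dC dall]] := eqVneq C [::].
    by exists c; rewrite ?mem_head //= lexx.
  have [cd|dc] := leP c d.
    exists c; rewrite ?mem_head //= lexx /=.
    by apply/allP => e /(allP dall) /= de; exact: le_trans de.
  by exists d; rewrite ?in_cons ?dC ?orbT //= (ltW dc).
have [a aA amin] := mins A' isT; have [b bB bmin] := mins B sB.
have zero (C : seq R) c : all (>= c) C -> \sum_(d <- C) Num.max (c - d) 0 = 0.
  move=> call; rewrite big_seq big1 // => d dC.
  by apply/max_idPr; rewrite subr_le0; exact: (allP call).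
have ab : a = b.
  apply/eqP; rewrite eq_le !leNgt; apply/andP; split; apply/negP => lt.
    by have := sum_max_gt0 bB lt; rewrite -h zero // ltxx.
  by have := sum_max_gt0 aA lt; rewrite h zero // ltxx.
rewrite -ab in bB; rewrite (perm_trans (perm_to_rem aA)) //.
rewrite perm_sym (perm_trans (perm_to_rem bB)) // perm_cons perm_sym.
apply: ih; first by rewrite size_rem // -ltnS (leq_trans _ sA).
move=> s; have := h s.
rewrite (perm_big _ (perm_to_rem aA)) (perm_big _ (perm_to_rem bB)) /=.
by rewrite !big_cons => /addrI.
Qed.

(** The extra term of [maxpsum_rotations] for [s - z] is the hinge sum of [n.+1] copies of the mean
    of [z]. So two multisets of fitted values have equal hinge sums, hence coincide, and their
    squares can be summed. *)
Lemma isoreg_rotations n z (X X' : nat -> nat -> R) :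
  (forall j, isoreg n.+1 (rotf n.+1 j z) (X j)) ->
  (forall j, isoreg n (rotf n.+1 j z) (X' j)) ->
  \sum_(j < n.+1) \sum_(i < n.+1) X j i ^+ 2 =
  \sum_(j < n.+1) \sum_(i < n) X' j i ^+ 2 + psum z n.+1 ^+ 2 / n.+1%:R.
Proof.
move=> iX iX'; set N := n.+1.
have N0 : N%:R != 0 :> R by rewrite pnatr_eq0.
pose A := [seq X p.1 p.2 | p : 'I_N * 'I_N].
pose B := [seq X' p.1 p.2 | p : 'I_N * 'I_n] ++ nseq N (psum z N / N%:R).
have sumA (f : R -> R) : \sum_(a <- A) f a = \sum_(j < N) \sum_(i < N) f (X j i).
  by rewrite /A big_image /= pair_bigA.
have sumB (f : R -> R) : \sum_(b <- B) f b =
    \sum_(j < N) \sum_(i < n) f (X' j i) + N%:R * f (psum z N / N%:R).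
  rewrite /B big_cat big_image [in RHS]pair_bigA; congr (_ + _).
  by rewrite big_nseq iter_addr addr0 mulr_natl.
have AB : perm_eq A B.
  apply: perm_eq_of_hinge => s; rewrite sumA sumB.
  under eq_bigr do rewrite -(isoreg_hinge _ (iX _)).
  under [X in _ = X + _]eq_bigr do rewrite -(isoreg_hinge _ (iX' _)).
  have := maxpsum_rotations n (fun i => s - z i); rewrite /rotf => ->.
  congr (_ + _); rewrite maxr_pMr ?ler0n // mulr0 psumB; congr (Num.max _ _).
  by rewrite mulrBr (mulrC N%:R (_ / _)) divfK // /psum sumr_const card_ord mulr_natl.
have := perm_big _ AB (F := fun a : R => a ^+ 2) (op := +%R) (x := 0) (P := xpredT).
rewrite /= sumA sumB => ->; congr (_ + _).
by rewrite expr_div_n expr2 invfM !mulrA; field.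
Qed.

End IsotonicRegression.

(** * Second moment of the standard normal law *)

Section GaussianSecondMoment.
Variable R : realType.
Local Notation mu := (@lebesgue_measure R).
Local Notation gauss := (normal_prob (0 : R) 1).
Local Notation phi := (normal_pdf (0 : R) 1).

(** The Radon-Nikodym derivative equals the normal density almost everywhere, as both have the same
    integral over every measurable set. *)
Lemma ge0_integral_gauss (f : R -> \bar R) :
  (forall x, 0 <= f x)%E -> measurable_fun setT f ->
  (\int[gauss]_x f x = \int[mu]_x (f x * (phi x)%:E))%E.
Proof.
move=> f0 mf.
rewrite -(Radon_Nikodym_SigmaFinite.change_of_variables
  (normal_prob_dominates 0 1)) //.
have hint := Radon_Nikodym_SigmaFinite.f_integrable (normal_prob_dominates (0 : R) 1).
apply: ae_eq_integral => //.
- by apply: emeasurable_funM => //; exact: measurable_int hint.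
- apply: emeasurable_funM => //; apply/measurable_EFinP.
  exact: measurable_normal_pdf.
- apply: ae_eqe_mul2l; apply: integral_ae_eq => //.
  + apply/measurable_EFinP; exact: measurable_normal_pdf.
  + move=> E _ mE; rewrite -Radon_Nikodym_SigmaFinite.f_integral //.
    exact: normal_prob_dominates.
Qed.

Let phiE x : phi x = normal_peak 1 * expR (- (x ^+ 2 / 2)).
Proof.
rewrite normal_pdfE ?oner_neq0 // /normal_fun subr0 mulNr.
by congr (_ * expR (- (_ / _))); rewrite expr1n mulr2n.
Qed.

Let phi_continuous : continuous phi.
Proof. by apply: continuous_normal_pdf; exact: oner_neq0. Qed.

Let sqr_shift_continuous (c : R) : continuous (fun z => (c + z) ^+ 2).
Proof.
move=> z; apply: (@continuous_comp _ _ _ (fun z : R => c + z) (fun z : R => z ^+ 2)).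
  by apply: cvgD; [exact: cvg_cst|exact: cvg_id].
exact: exprn_continuous.
Qed.

Let sqr_phi (c : R) := fun z : R => (c + z) ^+ 2 * phi z.

Let sqr_phi_continuous (c : R) : continuous (sqr_phi c).
Proof.
by move=> z; apply: cvgM; [exact: sqr_shift_continuous|exact: phi_continuous].
Qed.

Let sqr_phi_ge0 (c z : R) : 0 <= sqr_phi c z.
Proof. by rewrite mulr_ge0 ?sqr_ge0 ?normal_pdf_ge0. Qed.

(** Since [phi' = - z * phi], the derivative is [(z ^+ 2 + 2 * c * z - 1) * phi z], which is
    [((c + z) ^+ 2 - (c ^+ 2 + 1)) * phi z]. *)
Let primitive (c : R) := fun z : R => - (2 * c + z) * phi z.

Let is_derive_primitive (c z : R) :
  is_derive z 1 (primitive c) (sqr_phi c z - (c ^+ 2 + 1) * phi z).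
Proof.
rewrite (_ : primitive c = fun z => - (2 * c + z) *
   (normal_peak 1 * expR (- (z ^+ 2 / 2)))); last first.
  by apply/funext => x; rewrite /primitive phiE.
apply: is_derive_eq; rewrite /sqr_phi phiE /GRing.scale /=.
by field.
Qed.

Let primitive_cvg (c : R) : primitive c n%:R @[n --> \oo] --> 0.
Proof.
(* For [m = n.+1 >= 1], the linear factor is at most [(2 * |c| + 1) * m] and the exponential at most
   [2 / m ^+ 2], so the product is at most [K / m]. *)
pose K := (2 * `|c| + 1) * normal_peak 1 * 2.
rewrite -cvg_shiftS; apply/norm_cvg0P.
apply: (@squeeze_cvgr _ _ _ _ (cst 0) (fun n => K * harmonic n)).
- near=> n; rewrite normr_ge0 /= /primitive /= normrM normrN.
  have n0 : 0 < n.+1%:R :> R by rewrite ltr0n.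
  have n1 : 1 <= n.+1%:R :> R by rewrite ler1n.
  have p0 : 0 <= normal_peak 1 :> R by exact: normal_peak_ge0.
  have h1 : `|2 * c + n.+1%:R| <= (2 * `|c| + 1) * n.+1%:R.
    apply: (le_trans (ler_normD _ _)); rewrite normrM mulrDl mul1r.
    by rewrite (ger0_norm (ltW n0)) ger0_norm // lerD2r ler_peMr // mulr_ge0.
  have h2 : `|phi n.+1%:R| <= normal_peak 1 * (2 / n.+1%:R ^+ 2).
    rewrite ger0_norm ?normal_pdf_ge0 // phiE ler_wpM2l // expRN.
    rewrite -[2 / _]invf_div lef_pV2 ?posrE ?expR_gt0 ?divr_gt0 ?exprn_gt0 //.
    apply: le_trans (expR_ge1Dx _); by rewrite lerDr.
  apply: le_trans (ler_pM _ _ h1 h2) _; rewrite ?normr_ge0 //.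
  rewrite /K /harmonic /= le_eqVlt; apply/orP; left; apply/eqP; field.
  by rewrite lt0r_neq0.
- exact: cvg_cst.
- rewrite -[X in _ --> X](mulr0 K); apply: cvgM; first exact: cvg_cst.
  exact: cvg_harmonic.
Unshelve. all: by end_near. Qed.

Let half_moment (c : R) :
  (\int[mu]_(x in `[0%R, +oo[) (sqr_phi c x)%:E =
   (c ^+ 2 + 1)%:E * \int[mu]_(x in `[0%R, +oo[) (phi x)%:E
     + (2 * c * phi 0)%:E)%E.
Proof.
have mphi : measurable_fun setT phi by exact: measurable_normal_pdf.
have phi0 x : 0 <= phi x by exact: normal_pdf_ge0.
have msqr : measurable_fun setT (sqr_phi c).
  exact: continuous_measurable_fun.
have c10 : 0 <= c ^+ 2 + 1 by rewrite addr_ge0 ?sqr_ge0.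
have fin n : (\int[mu]_(x in `[0%R, n%:R]) (sqr_phi c x)%:E =
   (c ^+ 2 + 1)%:E * \int[mu]_(x in `[0%R, n%:R]) (phi x)%:E
     + (primitive c n%:R - primitive c 0)%:E)%E.
  (* The fundamental theorem of calculus is applied on a nondegenerate interval, so [n = 0] is
     treated apart. *)
  case: n => [|n].
    by rewrite set_itv1 !integral_set1 mule0 subrr adde0.
  have int (f : R -> R) : continuous f -> mu.-integrable `[0, n.+1%:R] (EFin \o f).
    move=> cf; apply: continuous_compact_integrable; first exact: segment_compact.
    exact: continuous_subspaceT.
  pose h z := sqr_phi c z - (c ^+ 2 + 1) * phi z.
  have ch : continuous h.
    move=> z; apply: cvgB; first exact: sqr_phi_continuous.
    by apply: cvgM; [exact: cvg_cst|exact: phi_continuous].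
  have FTC : (\int[mu]_(x in `[0%R, n.+1%:R]) (h x)%:E =
      (primitive c n.+1%:R)%:E - (primitive c 0)%:E)%E.
    have cp z : primitive c x @[x --> z] --> primitive c z.
      apply: differentiable_continuous; apply/derivable1_diffP.
      by have [] := is_derive_primitive c z.
    apply: continuous_FTC2 => //.
    - exact: continuous_subspaceT.
    - split.
      + by move=> x _; have [] := is_derive_primitive c x.
      + by apply: cvg_at_right_filter; exact: cp.
      + by apply: cvg_at_left_filter; exact: cp.
    - by move=> x _; rewrite derive1E (derive_val (is_derive := is_derive_primitive c x)).
  rewrite EFinB -FTC -ge0_integralZl //=; last 2 first.
    - by apply/measurable_EFinP/measurable_funTS.
    - by move=> x _; rewrite lee_fin.
  rewrite -integralD //=; last 2 first.
    - apply: (int (fun x => (c ^+ 2 + 1) * phi x)) => z.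
      by apply: cvgM; [exact: cvg_cst|exact: phi_continuous].
    - exact: int.
  by apply: eq_integral => x _; rewrite -EFinM -EFinD /h addrC subrK.
have l1 := @ge0_cvgn_integral R mu _ (sqr_phi_ge0 c) msqr.
have l2 := @ge0_cvgn_integral R mu _ phi0 mphi.
apply: (cvg_unique _ l1) => //; rewrite /mkset.
under eq_fun do rewrite fin.
have fin_phi : (\int[mu]_(x in `[0%R, +oo[) (phi x)%:E)%E \is a fin_num.
  apply: (integrable_fin_num) => //.
  apply: (integrableS _ _ (subsetT _)) => //; exact: integrable_normal_pdf.
apply: cvgeD.
- by rewrite fin_num_adde_defl.
- by apply: cvgeZl.
- apply: cvg_EFin; first by near=> n.
  rewrite (_ : 2 * c * phi 0 = 0 - primitive c 0); last first.
    by rewrite /primitive addr0 mulNr opprK add0r.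
  by apply: cvgB; [exact: primitive_cvg|exact: cvg_cst].
Unshelve. all: by end_near. Qed.

Lemma integralT_halves (f : R -> R) : (forall x, 0 <= f x) -> continuous f ->
  (\int[mu]_x (f x)%:E = \int[mu]_(x in `[0%R, +oo[) (f (- x))%:E
     + \int[mu]_(x in `[0%R, +oo[) (f x)%:E)%E.
Proof.
move=> f0 cf; have mf : measurable_fun [set: R] f by exact: continuous_measurable_fun.
rewrite -(setUv (`[0, +oo[%classic : set R)) ge0_integral_setU //=; last 4 first.
- exact: measurableC.
- by apply/measurable_EFinP; rewrite setUv.
- by move=> x _; rewrite lee_fin.
- exact/disj_setPCl.
rewrite addeC; congr (_ + _)%E.
rewrite setCitvr integral_itv_bndo_bndc; last exact/measurable_EFinP/measurable_funTS.
rewrite -{1}oppr0 ge0_integration_by_substitutionNy //.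
exact: continuous_subspaceT.
Qed.

(** By symmetry of the density, the negative half-line contributes the half moment at [- c]. The
    boundary terms [2 * c * phi 0] cancel, and each half has mass 1/2. *)
Lemma gauss_sqr_shift (c : R) :
  (\int[gauss]_z ((c + z) ^+ 2)%:E = (c ^+ 2 + 1)%:E)%E.
Proof.
rewrite ge0_integral_gauss; last 2 first.
- by move=> x; rewrite lee_fin sqr_ge0.
- by apply/measurable_EFinP; exact: continuous_measurable_fun.
under eq_integral do rewrite -EFinM.
rewrite (integralT_halves (sqr_phi_ge0 c)) //.
have phiN x : phi (- x) = phi x by rewrite !phiE sqrrN.
have -> : (\int[mu]_(x in `[0%R, +oo[) (sqr_phi c (- x))%:E =
    \int[mu]_(x in `[0%R, +oo[) (sqr_phi (- c) x)%:E)%E.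
  apply: eq_integral => x _; rewrite /sqr_phi phiN.
  by rewrite -sqrrN opprB addrC.
rewrite !half_moment.
have eN : (\int[mu]_(x in `[0%R, +oo[) (phi (- x))%:E =
    \int[mu]_(x in `[0%R, +oo[) (phi x)%:E)%E.
  by apply: eq_integral => x _; rewrite phiN.
have := integralT_halves (normal_pdf_ge0 (0 : R) 1) phi_continuous.
rewrite integral_normal_pdf eN => /esym tot.
move: tot; set I := (\int[mu]_(x in _) _)%E.
have fI : I \is a fin_num.
  apply: (integrable_fin_num) => //.
  apply: (integrableS _ _ (subsetT _)) => //; exact: integrable_normal_pdf.
rewrite -(fineK fI) -EFinD => -[tot].
rewrite -!EFinM -!EFinD; congr (_%:E); rewrite sqrrN.
have -> : fine I = 1 / 2 by lra.
by field.
Qed.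

End GaussianSecondMoment.

(** * Gaussian expectations *)

Section GaussianExpectation.
Variable R : realType.
Local Notation gauss := (normal_prob (0 : R) 1).
Local Notation GR := (measurableTypeR R).
Implicit Types (n m : nat) (s : seq R).
Local Open Scope ereal_scope.

(* [normal_prob] lives on [measurableTypeR R], whose measurable sets are those of
   [R] but with another display. *)
Lemma measurable_cons_pair n :
  measurable_fun setT (fun p : GR * n.-tuple R => [tuple of (p.1 : R) :: p.2]).
Proof.
apply: (@measurable_cons _ _ _ R (fun p : GR * n.-tuple R => p.1 : R)) => //.
exact: (@measurable_fst _ _ GR (n.-tuple R)).
Qed.

(** One law on tuples represents the iterated integral, which makes monotonicity, linearity, Tonelli
    and dominated convergence available for [gaussE]. *)
Lemma gaussE_integral n : exists P : probability (n.-tuple R) R,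
  forall f : n.-tuple R -> \bar R, (forall t, 0 <= f t) -> measurable_fun setT f ->
    gaussE f = \int[P]_t f t.
Proof.
elim: n => [|n [P hP]].
  exists (dirac [tuple]) => f f0 mf.
  by rewrite integral_dirac // diracT mul1e.
pose c (p : GR * n.-tuple R) : n.+1.-tuple R := [tuple of (p.1 : R) :: p.2].
have mc : measurable_fun setT c by exact: measurable_cons_pair.
pose C : {mfun _ >-> _} := HB.pack c (isMeasurableFun.Build _ _ _ _ _ mc).
exists (distribution (gauss \x P) C) => f f0 mf.
rewrite ge0_integral_pushforward //= preimage_setT.
rewrite fubini_tonelli1 //=; last exact: measurableT_comp.
apply: eq_integral => z _; rewrite /fubini_F /=; apply: hP => //.
by apply: measurableT_comp => //; apply: measurable_cons.
Qed.

Lemma gaussE_ge0 n (f : n.-tuple R -> \bar R) :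
  (forall t, 0 <= f t) -> 0 <= gaussE f.
Proof.
elim: n f => [|n ih] f f0 /=; first exact: f0.
by apply: integral_ge0 => z _; apply: ih.
Qed.

Lemma gaussE_le n (f g : n.-tuple R -> \bar R) : (forall t, 0 <= f t) ->
  measurable_fun setT f -> measurable_fun setT g ->
  (forall t, f t <= g t) -> gaussE f <= gaussE g.
Proof.
move=> f0 mf mg fg; have [P hP] := gaussE_integral n.
have g0 t : 0 <= g t by apply: le_trans (fg t).
by rewrite !hP //; apply: ge0_le_integral => //; exact: fg.
Qed.

Lemma gaussED n (f g : n.-tuple R -> \bar R) :
  (forall t, 0 <= f t) -> (forall t, 0 <= g t) ->
  measurable_fun setT f -> measurable_fun setT g ->
  gaussE (fun t => f t + g t) = gaussE f + gaussE g.
Proof.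
move=> f0 g0 mf mg; have [P hP] := gaussE_integral n.
rewrite !hP ?ge0_integralD //; first by move=> t; exact: adde_ge0.
exact: emeasurable_funD.
Qed.

Lemma gaussE_sum n k (f : 'I_k -> n.-tuple R -> \bar R) :
  (forall i t, 0 <= f i t) -> (forall i, measurable_fun setT (f i)) ->
  gaussE (fun t => \sum_(i < k) f i t) = \sum_(i < k) gaussE (f i).
Proof.
move=> f0 mf; have [P hP] := gaussE_integral n.
rewrite hP ?ge0_integral_sum //; last 2 first.
- by move=> t; exact: sume_ge0.
- exact: emeasurable_sum.
by apply: eq_bigr => i _; rewrite hP.
Qed.

Lemma gaussEZ n (c : R) (f : n.-tuple R -> \bar R) : (0 <= c)%R ->
  (forall t, 0 <= f t) -> measurable_fun setT f ->
  gaussE (fun t => c%:E * f t) = c%:E * gaussE f.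
Proof.
move=> c0 f0 mf; have [P hP] := gaussE_integral n.
rewrite !hP ?ge0_integralZl //; last exact: measurable_funeM.
by move=> t; rewrite mule_ge0.
Qed.

Lemma measurable_gaussE d (T : measurableType d) n (f : T -> n.-tuple R -> \bar R) :
  (forall x t, 0 <= f x t) ->
  measurable_fun setT (fun p : T * n.-tuple R => f p.1 p.2) ->
  measurable_fun setT (fun x => gaussE (f x)).
Proof.
move=> f0 mf; have [P hP] := gaussE_integral n.
rewrite (_ : (fun x => _) = fubini_F P (fun p => f p.1 p.2)); last first.
  apply/funext => x; rewrite hP //.
  by apply: (measurableT_comp mf (g := pair x)).
by apply: measurable_fun_fubini_tonelli_F => // -[x t]; exact: f0.
Qed.

Lemma integral_cst_probability d (T : measurableType d) (P : probability T R)
  (c : \bar R) : \int[P]_x c = c.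
Proof.
have /= -> := integral_cst P measurableT c.
rewrite -[RHS]mule1; congr (_ * _); exact: probability_setT.
Qed.

Lemma gauss_cst (c : \bar R) : \int[gauss]_z c = c.
Proof. exact: (@integral_cst_probability _ _ gauss). Qed.

Lemma gaussE_cst n (c : \bar R) : gaussE (fun _ : n.-tuple R => c) = c.
Proof. by elim: n => //= n ih; rewrite ih gauss_cst. Qed.

(** Integrands on sequences rather than tuples let prefixes, suffixes and rotations be taken without
    casts between tuple types. *)
Lemma gaussE_take m n (f : seq R -> \bar R) :
  gaussE (fun t : (m + n).-tuple R => f (take m t)) =
  gaussE (fun t : m.-tuple R => f t).
Proof.
elim: m f => [|m ih] f; first by under eq_fun do rewrite take0; rewrite gaussE_cst.
by apply: eq_integral => z _; exact: (ih (fun s => f (z :: s))).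
Qed.

Lemma gaussE_drop m n (f : seq R -> \bar R) :
  gaussE (fun t : (m + n).-tuple R => f (drop m t)) =
  gaussE (fun t : n.-tuple R => f t).
Proof.
elim: m => [|m ih]; first by under eq_fun do rewrite drop0.
by rewrite -[RHS]gauss_cst; apply: eq_integral => z _; exact: ih.
Qed.

Lemma gaussE_rcons n (f : seq R -> \bar R) :
  gaussE (fun t : n.+1.-tuple R => f t) =
  gaussE (fun t : n.-tuple R => \int[gauss]_z f (rcons t z)).
Proof.
elim: n f => [//|n ih] f.
by apply: eq_integral => z _; exact: (ih (fun s => f (z :: s))).
Qed.

Lemma measurable_nth n i :
  measurable_fun setT (fun t : n.-tuple R => nth 0%R t i).
Proof.
have [iln|nli] := ltnP i n.
  under eq_fun do rewrite -(tnth_nth 0%R _ (Ordinal iln)).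
  exact: measurable_tnth.
by under eq_fun do rewrite nth_default ?size_tuple //; exact: measurable_cst.
Qed.

Lemma measurable_tuple d (T : measurableType d) n (h : T -> n.-tuple R) :
  (forall i, (i < n)%N -> measurable_fun setT (fun x => nth 0%R (h x) i)) ->
  measurable_fun setT h.
Proof.
move=> mh; apply/measurable_fun_tnthP => i; have := mh i (ltn_ord i).
by apply: eq_measurable_fun => x _ /=; rewrite (tnth_nth 0%R).
Qed.

Lemma measurable_rot1 n : measurable_fun setT (fun t : n.-tuple R => [tuple of rot 1 t]).
Proof.
apply: measurable_tuple => i iln /=; rewrite /rot.
have [h|h] := ltnP i (n - 1).
  under eq_fun do rewrite nth_cat size_drop size_tuple h nth_drop.
  exact: measurable_nth.
under eq_fun do rewrite nth_cat size_drop size_tuple ltnNge h.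
have [i1|i1] := ltnP (i - (n - 1)) 1.
  by under eq_fun do rewrite nth_take //; exact: measurable_nth.
under eq_fun do rewrite nth_default ?size_take_min ?geq_min ?i1 //.
exact: measurable_cst.
Qed.

(** The rotation moves the outermost integral to the innermost place, where [gaussE_rcons] also
    exposes a coordinate; Tonelli exchanges the two. *)
Lemma gaussE_rot1 n (f : seq R -> \bar R) : (forall s, 0 <= f s) ->
  measurable_fun setT (fun t : n.-tuple R => f t) ->
  gaussE (fun t : n.-tuple R => f (rot 1 t)) = gaussE (fun t : n.-tuple R => f t).
Proof.
case: n => [//|n] f0 mf; have [P hP] := gaussE_integral n.
have mg : measurable_fun setT
    (fun p : GR * n.-tuple R => f (rcons p.2 p.1)).
  under eq_fun do rewrite -rot1_cons.
  apply: (measurableT_comp (f := fun t : n.+1.-tuple R => f (rot 1 t))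
    (g := fun p : GR * n.-tuple R => [tuple of (p.1 : R) :: p.2])).
    apply: (measurableT_comp mf (g := fun t : n.+1.-tuple R => [tuple of rot 1 t])).
    exact: measurable_rot1.
  exact: measurable_cons_pair.
rewrite gaussE_rcons /= hP; last 2 first.
- by move=> t; apply: integral_ge0.
- by apply: (measurable_fun_fubini_tonelli_G (m1 := gauss) _ mg) => p.
transitivity (\int[gauss]_z \int[P]_t f (rcons t z)).
  apply: eq_integral => z _; under eq_fun do rewrite rot1_cons.
  by rewrite hP //; apply: (measurableT_comp mg (g := pair z)).
by have := fubini_tonelli (m1 := gauss) (m2 := P) _ mg (fun _ => f0 _).
Qed.

Lemma gaussE_rot n j (f : seq R -> \bar R) : (forall s, 0 <= f s) ->
  measurable_fun setT (fun t : n.-tuple R => f t) ->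
  measurable_fun setT (fun t : n.-tuple R => f (iter j (rot 1) t)) /\
  gaussE (fun t : n.-tuple R => f (iter j (rot 1) t)) =
  gaussE (fun t : n.-tuple R => f t).
Proof.
move=> f0 mf; elim: j => [//|j [mj ih]].
under [X in measurable_fun _ X]eq_fun do rewrite iterSr.
under [X in gaussE X = _]eq_fun do rewrite iterSr.
split; last by rewrite (@gaussE_rot1 n (fun s => f (iter j (rot 1) s))).
apply: (measurableT_comp mj (g := fun t : n.-tuple R => [tuple of rot 1 t])).
exact: measurable_rot1.
Qed.

Lemma measurable_sum_nth n : measurable_fun setT
  (fun t : n.-tuple R => \sum_(i < n) nth 0 t i)%R.
Proof. by apply: measurable_sum => i; exact: measurable_nth. Qed.

(** The offset [c] carries the induction: it absorbs the coordinate that is held fixed by the outer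
    integral. *)
Lemma gaussE_sum_sqr n (c : R) :
  gaussE (fun t : n.-tuple R => ((c + \sum_(i < n) nth 0 t i) ^+ 2)%:E)%R =
  (c ^+ 2 + n%:R)%:E.
Proof.
elim: n c => [|n ih] c /=; first by rewrite big_ord0 !addr0.
under eq_integral => z _.
  under eq_fun do rewrite big_ord_recl /= addrA.
  rewrite ih EFinD; over.
rewrite ge0_integralD //; last 2 first.
- by move=> z _; rewrite lee_fin sqr_ge0.
- apply/measurable_EFinP; apply: measurable_funX; exact: measurable_funD.
by rewrite gauss_sqr_shift gauss_cst -EFinD -addrA nat1r.
Qed.

(** [f] is the infimum of the countably many cones [g q] with rational apex, so each strict sublevel
    set is a countable union of theirs. *)
Lemma lipschitz_measurable n (f : n.-tuple R -> R) :
  (forall x y, f x <= f y + \sum_(i < n) `|nth 0 x i - nth 0 y i|)%R ->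
  measurable_fun setT f.
Proof.
move=> lip; apply: (measurability _ (RGenInftyO.measurableE R)) => //.
move=> _ [_ [c ->] <-]; rewrite setTI.
pose q2r (q : n.-tuple rat) : n.-tuple R := [tuple of map ratr q].
pose g q (x : n.-tuple R) := (f (q2r q) + \sum_(i < n) `|nth 0 x i - nth 0 (q2r q) i|)%R.
suff -> : f @^-1` `]-oo, c[%classic = \bigcup_q (g q @^-1` `]-oo, c[%classic).
  apply: countable_bigcupT_measurable => [|q]; first exact: countableP.
  rewrite -[X in measurable X]setTI.
  have mg : measurable_fun setT (g q); last exact: mg.
  apply: measurable_funD => //; apply: measurable_sum => i.
  by apply: measurableT_comp => //; apply: measurable_funB => //; exact: measurable_nth.
apply/seteqP; split => [x /= fx|x [q _ /=]]; last first.
  by rewrite !in_itv /= => h; rewrite (le_lt_trans (lip x (q2r q))).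
move: fx; rewrite in_itv /= => fx.
(* An apex within [e] of [x] in each coordinate costs at most [n * e] twice, once in [f] and once in
   the distance; [n.+1] keeps the total strictly below [c - f x], also for [n = 0]. *)
pose e := ((c - f x) / (2 * n.+1%:R))%R.
have e0 : (0 < e)%R by rewrite divr_gt0 ?subr_gt0 ?mulr_gt0.
have /choice[q hq] : forall i : 'I_n, exists q : rat,
    (`|nth 0 x i - ratr q| < e)%R.
  move=> i; have [q] := @rat_in_itvoo R (nth 0 x i - e)%R (nth 0 x i + e)%R
    ltac:(by rewrite ltrD2l gtrN).
  by rewrite in_itv /= => hq; exists q; rewrite distrC ltr_distl.
exists (mktuple q) => //=; rewrite in_itv /= /g.
set y := q2r _.
have hy (i : 'I_n) : (nth 0 y i = ratr (q i))%R.
  by rewrite -tnth_nth tnth_map tnth_mktuple.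
have sle : (\sum_(i < n) `|nth 0 x i - nth 0 y i| <= n%:R * e)%R.
  rewrite -[n in (n%:R * _)%R]card_ord mulr_natl -sumr_const; apply: ler_sum => i _.
  by rewrite hy ltW.
have := lip y x; under eq_bigr do rewrite distrC.
move=> lipy; apply: (@le_lt_trans _ _ (f x + 2 * (n%:R * e)))%R.
  have := lerD lipy sle; lra.
rewrite -ltrBrDl /e.
have n0 : (0 < n.+1%:R :> R)%R by [].
rewrite (_ : 2 * _ = (c - f x) * (n%:R / n.+1%:R))%R; last by field.
by rewrite gtr_pMr ?subr_gt0 // ltr_pdivrMr // mul1r ltr_nat.
Qed.

End GaussianExpectation.

(** * The null risk *)

Section NullRisk.
Variable R : realType.
Implicit Types (n m k : nat) (s : seq R).

(** The greedy fit is a minimiser, so the choice in [eta_mono] is a genuine one; Pythagoras then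
    forces the chosen point to equal the greedy fit. *)
Lemma isoreg_eta_mono n (y : n.-tuple R) :
  isoreg n (nth 0 y) (nth 0 (eta_mono y)).
Proof.
have [x [ix _]] := isoreg_exists n (nth 0 y).
pose X : n.-tuple R := [tuple x i | i < n].
have XE i : (i < n)%N -> nth 0 X i = x i.
  by move=> iln; rewrite -(tnth_nth 0 X (Ordinal iln)) tnth_mktuple.
have iX : isoreg n (nth 0 y) (nth 0 X) by apply: isoreg_ext ix => // i /XE.
have sqE (u v : n.-tuple R) : sqdist u v = \sum_(i < n) (nth 0 u i - nth 0 v i) ^+ 2.
  by apply: eq_bigr => i _; rewrite !(tnth_nth 0).
have [mX _ _ _] := iX.
have hX : (@monoset R n X /\ forall x', @monoset R n x' -> sqdist y X <= sqdist y x').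
  split=> [//|v mv]; rewrite !sqE.
  apply: le_trans (isoreg_pythagoras iX mv); rewrite lerDl.
  by apply: sumr_ge0 => i _; exact: sqr_ge0.
have [me le] : (@monoset R n (eta_mono y) /\
    forall x', @monoset R n x' -> sqdist y (eta_mono y) <= sqdist y x').
  exact: (xgetPex y (ex_intro (fun x : n.-tuple R => @monoset R n x /\
    forall x', @monoset R n x' -> sqdist y x <= sqdist y x') X hX)).
apply: isoreg_ext (iX) => // i iln; apply/eqP; rewrite -subr_eq0; apply/eqP.
apply: (@sum_sqr_eq0 _ n (fun j => nth 0 X j - nth 0 (eta_mono y) j)) => //.
have := isoreg_pythagoras iX me; have := le _ mX; rewrite !sqE; lra.
Qed.

Definition etas s : seq R := eta_mono (in_tuple s).

Lemma etas_tuple n (t : n.-tuple R) : etas t = eta_mono t.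
Proof.
move: (size_tuple t); case: t => s ps /= e; subst n.
by congr (tval (eta_mono _)); exact: val_inj.
Qed.

Lemma isoreg_etas s : isoreg (size s) (nth 0 s) (nth 0 (etas s)).
Proof. exact: isoreg_eta_mono (in_tuple s). Qed.

(** Nonexpansiveness in the Euclidean norm, which is at most the sum of absolute values, makes each
    coordinate Lipschitz. *)
Lemma measurable_eta_mono n i :
  measurable_fun setT (fun y : n.-tuple R => nth 0 (eta_mono y) i).
Proof.
have [iln|nli] := ltnP i n; last first.
  by under eq_fun do rewrite nth_default ?size_tuple //; exact: measurable_cst.
apply: lipschitz_measurable => x y.
have := isoreg_nonexpansive (isoreg_eta_mono x) (isoreg_eta_mono y).
set a := nth 0 (eta_mono x); set b := nth 0 (eta_mono y).
set S := \sum_(j < n) `|nth 0 x j - nth 0 y j|.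
have S0 : 0 <= S by apply: sumr_ge0.
have S2 : \sum_(j < n) (nth 0 x j - nth 0 y j) ^+ 2 <= S ^+ 2.
  rewrite expr2 {1}/S mulr_suml; apply: ler_sum => j _.
  rewrite -real_normK ?num_real // expr2 ler_wpM2l //.
  by rewrite /S (bigD1 j) //= lerDl sumr_ge0.
move=> /le_trans /(_ S2); rewrite (bigD1 (Ordinal iln)) //= => h.
have : (a i - b i) ^+ 2 <= S ^+ 2.
  by apply: le_trans h; rewrite lerDl sumr_ge0 // => j _; exact: sqr_ge0.
move=> h2; rewrite -lerBlDl (le_trans (ler_norm _)) //.
by rewrite -ler_sqr ?nnegrE // real_normK ?num_real.
Qed.

Definition nsq s : R := \sum_(i < size s) nth 0 (etas s) i ^+ 2.

Lemma nsq_ge0 s : 0 <= nsq s.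
Proof. by apply: sumr_ge0 => i _; exact: sqr_ge0. Qed.

Lemma measurable_nsq d (T : measurableType d) n (h : T -> seq R) :
  (forall x, size (h x) = n) ->
  (forall i, measurable_fun setT (fun x => nth 0 (h x) i)) ->
  measurable_fun setT (fun x => nsq (h x)).
Proof.
move=> hn mh; pose H x : n.-tuple R := Tuple (introT eqP (hn x)).
have mH : measurable_fun setT H by apply: measurable_tuple => i _; exact: mh.
rewrite (_ : (fun x => _) = fun x => \sum_(i < n) nth 0 (eta_mono (H x)) i ^+ 2).
  apply: measurable_sum => i; apply: measurable_funX.
  exact: (measurableT_comp (@measurable_eta_mono n i) mH).
by apply/funext => x; rewrite /nsq hn -(etas_tuple (H x)).
Qed.

Lemma rmonoE l : rmono R l = gaussE (fun t : l.-tuple R => (nsq t)%:E).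
Proof.
congr gaussE; apply/funext => t; congr (_%:E).
rewrite /sqdist /nsq size_tuple etas_tuple; apply: eq_bigr => i _.
by rewrite !(tnth_nth 0) /= nth_nseq ltn_ord subr0.
Qed.

Lemma size_iter_rot1 s j : size (iter j (rot 1) s) = size s.
Proof. by elim: j => //= j ih; rewrite size_rot. Qed.

Lemma nth_iter_rot1 s j i : (i < size s)%N ->
  nth 0 (iter j (rot 1) s) i = nth 0 s ((i + j) %% size s)%N.
Proof.
have rot1E u k : (k < size u)%N -> nth 0 (rot 1 u) k = nth 0 u ((k + 1) %% size u)%N.
  case: u => [//|x u] /= kn; rewrite rot1_cons nth_rcons addn1.
  have [ku|uk|ku] := ltngtP k (size u).
  - by rewrite modn_small.
  - by move: kn; rewrite ltnS leqNgt uk.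
  - by rewrite ku modnn.
elim: j i => [|j ih] i iln; first by rewrite addn0 modn_small.
have s0 : (0 < size s)%N by exact: leq_ltn_trans iln.
rewrite iterS rot1E ?size_iter_rot1 // ih ?ltn_mod //.
by rewrite modnDml addn1 addSnnS.
Qed.

Lemma nsq_rotations n (t : n.+1.-tuple R) :
  \sum_(j < n.+1) nsq (iter j (rot 1) t) =
  \sum_(j < n.+1) nsq (take n (iter j (rot 1) t)) +
    (\sum_(i < n.+1) nth 0 t i) ^+ 2 / n.+1%:R.
Proof.
have st j : size (iter j (rot 1) t) = n.+1 by rewrite size_iter_rot1 size_tuple.
have stt j : size (take n (iter j (rot 1) t)) = n by rewrite size_takel ?st.
have := @isoreg_rotations R n (nth 0 t) (fun j => nth 0 (etas (iter j (rot 1) t)))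
  (fun j => nth 0 (etas (take n (iter j (rot 1) t)))).
have -> : psum (nth 0 t) n.+1 = \sum_(i < n.+1) nth 0 t i by [].
move=> h; under eq_bigr do rewrite /nsq st.
under [X in _ = X + _]eq_bigr do rewrite /nsq stt.
apply: h.
- move=> j; have := isoreg_etas (iter j (rot 1) t); rewrite st.
  by apply: isoreg_ext => // i iln; rewrite nth_iter_rot1 size_tuple.
- move=> j; have := isoreg_etas (take n (iter j (rot 1) t)); rewrite stt.
  apply: isoreg_ext => // i iln; rewrite nth_take // nth_iter_rot1 size_tuple //.
  exact: ltnW.
Qed.

Definition harm n : R := \sum_(i < n) i.+1%:R^-1.

Lemma harmS n : harm n.+1 = harm n + n.+1%:R^-1.
Proof. by rewrite /harm big_ord_recr. Qed.

Lemma rmono_harm l : rmono R l = (harm l)%:E.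
Proof.
elim: l => [|n ih]; first by rewrite rmonoE /= /nsq /harm !big_ord0.
have mn (m : nat) : measurable_fun setT (fun t : m.-tuple R => (nsq t)%:E).
  apply/measurable_EFinP; apply: (@measurable_nsq _ _ m) => [t|i].
    exact: size_tuple.
  exact: measurable_nth.
have mtake : measurable_fun setT (fun t : n.+1.-tuple R => (nsq (take n t))%:E).
  apply/measurable_EFinP; apply: (@measurable_nsq _ _ n) => [t|i].
    by rewrite size_takel ?size_tuple.
  have [iln|nli] := ltnP i n.
    by under eq_fun do rewrite nth_take //; exact: measurable_nth.
  under eq_fun do rewrite nth_default ?size_take_min ?geq_min ?nli //.
  exact: measurable_cst.
have r1 j := @gaussE_rot R n.+1 j (fun s => (nsq s)%:E) nsq_ge0 (mn _).
have r2 j := @gaussE_rot R n.+1 j (fun s => (nsq (take n s))%:E)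
  (fun s => nsq_ge0 _) mtake.
(* Without its last entry the noise is standard normal in dimension [n], so the induction hypothesis
   applies. *)
have take_r : gaussE (fun t : n.+1.-tuple R => (nsq (take n t))%:E) = (harm n)%:E.
  rewrite -ih rmonoE; have := @gaussE_take R n 1 (fun s => (nsq s)%:E).
  by rewrite addn1.
have L : gaussE (fun t : n.+1.-tuple R => (\sum_(j < n.+1) nsq (iter j (rot 1) t))%:E)
    = (rmono R n.+1 *+ n.+1)%E.
  under eq_fun do rewrite -sumEFin.
  rewrite gaussE_sum; last 2 first.
  - by move=> j t; rewrite lee_fin nsq_ge0.
  - by move=> j; exact: (r1 j).1.
  rewrite (eq_bigr (fun=> rmono R n.+1)) ?sumr_const ?card_ord //.
  by move=> j _; rewrite (r1 j).2 rmonoE.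
(* Second evaluation of the same expectation. The sum of the entries has second moment [n.+1], so
   the mean contributes exactly 1. *)
have : gaussE (fun t : n.+1.-tuple R => (\sum_(j < n.+1) nsq (iter j (rot 1) t))%:E)
    = (n.+1%:R * harm n + 1)%:E.
  under eq_fun do rewrite nsq_rotations EFinD -sumEFin.
  rewrite gaussED; last 4 first.
  - by move=> t; apply: sume_ge0 => j _; rewrite lee_fin nsq_ge0.
  - by move=> t; rewrite lee_fin divr_ge0 ?sqr_ge0.
  - by apply: emeasurable_sum => j; exact: (r2 j).1.
  - apply/measurable_EFinP; apply: measurable_funM => //; apply: measurable_funX.
    exact: measurable_sum_nth.
  rewrite gaussE_sum; last 2 first.
  - by move=> j t; rewrite lee_fin nsq_ge0.
  - by move=> j; exact: (r2 j).1.
  rewrite (eq_bigr (fun=> (harm n)%:E)); last by move=> j _; rewrite (r2 j).2.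
  rewrite sumr_const card_ord EFinD; congr (_ + _)%E.
    by rewrite EFinM mule_natl.
  under eq_fun do rewrite mulrC EFinM -[X in (X ^+ 2)%:E]add0r.
  rewrite gaussEZ ?invr_ge0 //; last 2 first.
  - by move=> t; rewrite lee_fin sqr_ge0.
  - apply/measurable_EFinP; apply: measurable_funX; apply: measurable_funD => //.
    exact: measurable_sum_nth.
  by rewrite gaussE_sum_sqr expr0n add0r -EFinM mulVf.
rewrite L -mule_natl => e.
have n0 : n.+1%:R != 0 :> R by [].
(* Finiteness of [rmono R n.+1] is not yet known, so the equation is solved inside the extended
   reals. *)
have -> : rmono R n.+1 = (n.+1%:R^-1%:E * (n.+1%:R%:E * rmono R n.+1))%E.
  by rewrite muleA -EFinM mulVf // mul1e.
by rewrite e -EFinM harmS; congr (_%:E); field.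
Qed.

End NullRisk.

(** * Blocks and staircases *)

Section Blocks.
Variable R : realType.
Implicit Types (n m k l t : nat) (ls : seq nat) (x u v : nat -> R) (z : seq R).

Fixpoint blockwise (P : nat -> (nat -> R) -> Prop) ls x : Prop :=
  if ls is l :: ls' then P l x /\ blockwise P ls' (shift l x) else True.

Definition constf n x := forall i, (i < n)%N -> x i = x 0%N.

Fixpoint block_nsq ls z : R :=
  if ls is l :: ls' then nsq (take l z) + block_nsq ls' (drop l z) else 0.

(** The projection of [z] onto the product of the monotone cones over the blocks; [block_nsq] is its
    squared norm. *)
Fixpoint block_etas ls z : seq R :=
  if ls is l :: ls' then etas (take l z) ++ block_etas ls' (drop l z) else [::].
Arguments block_etas : simpl never.

Lemma block_etas_cons l ls z :
  block_etas (l :: ls) z = etas (take l z) ++ block_etas ls (drop l z).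
Proof. by []. Qed.

Lemma shiftD m k x : shift (m + k) x = shift k (shift m x).
Proof. by apply/funext => i; rewrite /shift addnA. Qed.

Lemma size_etas z : size (etas z) = size z.
Proof. by rewrite /etas size_tuple. Qed.

Lemma isoreg_take l z : (l <= size z)%N ->
  isoreg l (nth 0 z) (nth 0 (etas (take l z))).
Proof.
move=> lz; have := isoreg_etas (take l z); rewrite size_takel //.
by apply: isoreg_ext => // i il; rewrite nth_take.
Qed.

Lemma nsq_take l z : (l <= size z)%N ->
  nsq (take l z) = \sum_(i < l) nth 0 (etas (take l z)) i ^+ 2.
Proof. by move=> lz; rewrite /nsq size_takel. Qed.

Lemma block_dot ls u z : size z = sumn ls -> blockwise (@monof R) ls u ->
  2 * \sum_(i < sumn ls) nth 0 z i * u i <=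
  block_nsq ls z + \sum_(i < sumn ls) u i ^+ 2.
Proof.
elim: ls u z => [|l ls ih] u z /= sz; first by rewrite !big_ord0 mulr0 addr0.
move=> [mu bu]; rewrite !big_split_ord /=.
have lz : (l <= size z)%N by rewrite sz leq_addr.
have := isoreg_dot_le (isoreg_take lz) mu; rewrite -nsq_take //.
have := ih _ (drop l z) _ bu; rewrite size_drop sz addKn => /(_ erefl).
rewrite (eq_bigr (fun i : 'I__ => nth 0 z (l + i)%N * u (l + i)%N)); last first.
  by move=> i _; rewrite nth_drop.
rewrite /shift; lra.
Qed.

Lemma block_const_mono ls x v : blockwise constf ls x -> monof (sumn ls) v ->
  blockwise (@monof R) ls (fun i => v i - x i).
Proof.
elim: ls x v => [//|l ls ih] x v /= [cx bx] mv; split.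
  move=> t tl; rewrite (cx t) ?(cx t.+1) //; last exact: ltnW.
  by rewrite lerD2r mv // (leq_trans tl) // leq_addr.
apply: (ih (shift l x) (shift l v)) => // t tl.
by rewrite /shift addnS mv // -addnS ltn_add2l.
Qed.

Lemma nth_block_etasl l ls z i : (l <= size z)%N -> (i < l)%N ->
  nth 0 (block_etas (l :: ls) z) i = nth 0 (etas (take l z)) i.
Proof. by move=> lz il; rewrite block_etas_cons nth_cat size_etas size_takel // il. Qed.

Lemma nth_block_etasr l ls z i : (l <= size z)%N ->
  nth 0 (block_etas (l :: ls) z) (l + i) = nth 0 (block_etas ls (drop l z)) i.
Proof.
by move=> lz; rewrite block_etas_cons nth_cat size_etas size_takel // ltnNge leq_addr /= addKn.
Qed.

Lemma block_nsqE ls z : size z = sumn ls ->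
  \sum_(i < sumn ls) nth 0 (block_etas ls z) i ^+ 2 = block_nsq ls z.
Proof.
elim: ls z => [|l ls ih] z sz; first by rewrite big_ord0.
have lz : (l <= size z)%N by rewrite sz leq_addr.
rewrite -[sumn (l :: ls)]/(l + sumn ls)%N big_split_ord /= nsq_take //.
rewrite -ih ?size_drop ?sz ?addKn //.
congr (_ + _); apply: eq_bigr => i _; first by rewrite nth_block_etasl.
by rewrite nth_block_etasr.
Qed.

(** The least-squares problem over a product of cones decouples into one projection per block. *)
Lemma block_etas_min ls z u : size z = sumn ls -> blockwise (@monof R) ls u ->
  \sum_(i < sumn ls) (nth 0 z i - nth 0 (block_etas ls z) i) ^+ 2 <=
  \sum_(i < sumn ls) (nth 0 z i - u i) ^+ 2.
Proof.
elim: ls u z => [|l ls ih] u z sz; first by rewrite !big_ord0.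
have lz : (l <= size z)%N by rewrite sz leq_addr.
move=> [mu bu]; rewrite -[sumn (l :: ls)]/(l + sumn ls)%N !big_split_ord /= lerD //.
  apply: le_trans (isoreg_pythagoras (isoreg_take lz) mu).
  under eq_bigr do rewrite nth_block_etasl //.
  by rewrite lerDl; apply: sumr_ge0 => i _; exact: sqr_ge0.
under eq_bigr do rewrite nth_block_etasr // -nth_drop.
under [leRHS]eq_bigr do rewrite -nth_drop.
by apply: (ih (shift l u)) => //; rewrite size_drop sz addKn.
Qed.

(** Index of the block containing position [i]; past the last block the value is [size ls]. *)
Fixpoint stair ls (i : nat) : nat :=
  if ls is l :: ls' then (if (i < l)%N then 0 else (stair ls' (i - l)).+1) else 0.

Lemma stair_leS ls i : (stair ls i <= stair ls i.+1)%N.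
Proof.
elim: ls i => //= l ls ih i; case: (ltnP i l) => il; first by case: ifP.
by rewrite (ltnNge i.+1) (leqW il) /= subSn // ltnS ih.
Qed.

Lemma stair_lt ls i : (i < sumn ls)%N -> (stair ls i < size ls)%N.
Proof.
elim: ls i => //= l ls ih i isz; case: (ltnP i l) => il //.
by rewrite ltnS ih // ltn_subLR.
Qed.

Lemma stair_const ls (A : R) : blockwise constf ls (fun i => A * (stair ls i)%:R).
Proof.
(* The offset [c] counts the blocks already passed. *)
suff gen c : blockwise constf ls (fun i => A * (c + stair ls i)%:R).
  exact: (gen 0%N).
elim: ls c => //= l ls ih c; split.
  by move=> i il; rewrite il (leq_ltn_trans _ il).
have := ih c.+1; congr (blockwise _ _ _).
by apply/funext => i; rewrite /shift ltnNge leq_addr /= addKn addnS.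
Qed.

Lemma stair_jumps ls n :
  (count (fun t => (stair ls t < stair ls t.+1)%N) (iota 0 n) <= stair ls n)%N.
Proof.
elim: n => [//|n ih]; rewrite -addn1 iotaD count_cat /= add0n addn0 addn1.
case: ltnP => [lt|_]; first by rewrite addn1 (leq_ltn_trans ih).
by rewrite addn0 (leq_trans ih) // stair_leS.
Qed.

Lemma block_etas_mono ls z t : size z = sumn ls -> (t.+1 < sumn ls)%N ->
  stair ls t = stair ls t.+1 ->
  nth 0 (block_etas ls z) t <= nth 0 (block_etas ls z) t.+1.
Proof.
elim: ls z t => [//|l ls ih] z t sz tn.
have lz : (l <= size z)%N by rewrite sz leq_addr.
rewrite /=; case: (ltnP t l) => tl; case: (ltnP t.+1 l) => tl1 // => e.
- rewrite !nth_block_etasl //.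
  by have [mx _ _ _] := isoreg_take lz; exact: mx.
- rewrite -(subnKC tl) -addnS !nth_block_etasr //.
  apply: ih; first by rewrite size_drop sz addKn.
    by rewrite -subSn // ltn_subLR // (leq_trans tl).
  by case: e; rewrite subSn.
Qed.

Definition njumpf n x := count (fun t => x t < x t.+1) (iota 0 n.-1).

Lemma njumpf_shift n x : njumpf n.+2 x = ((x 0%N < x 1%N)%R + njumpf n.+1 (shift 1 x))%N.
Proof. by rewrite /njumpf /= (iotaDl 1 0) count_map. Qed.

Lemma blocks_exist n x : monof n.+1 x -> exists ls,
  [/\ sumn ls = n.+1, all (ltn 0) ls, blockwise constf ls x &
      size ls = (njumpf n.+1 x).+1].
Proof.
elim: n x => [|n ih] x mx.
  by exists [:: 1%N]; split=> //=; split=> // -[].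
have [|ls [sls pls bls szls]] := ih (shift 1 x).
  by move=> t tn; exact: mx.
have := mx 0%N isT; rewrite le_eqVlt => /orP[/eqP x01|x01].
  case: ls sls pls bls szls => [//|l ls] /= sls /andP[l0 pls] [cx bx] szls.
  exists (l.+1 :: ls); split=> //=.
  - by rewrite addSn sls.
  - split=> [[//|i] il|]; last by rewrite -add1n shiftD.
    by have := cx i il; rewrite /shift !add1n => ->; rewrite x01.
  - by rewrite njumpf_shift x01 ltxx szls.
exists (1%N :: ls); split=> //=.
- by rewrite add1n sls.
- by split=> // -[].
- by rewrite njumpf_shift x01 szls.
Qed.

End Blocks.

(** * Loss at a fixed signal *)

Section RiskBounds.
Variable R : realType.
Implicit Types (ls : seq nat).

Definition loss N (x z : N.-tuple R) : R := sqdist x (eta_mono (tadd x z)).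

Lemma sqdistE N (x y : N.-tuple R) :
  sqdist x y = \sum_(i < N) (nth 0 x i - nth 0 y i) ^+ 2.
Proof. by apply: eq_bigr => i _; rewrite !(tnth_nth 0). Qed.

Lemma nth_tadd N (x y : N.-tuple R) i : (i < N)%N ->
  nth 0 (tadd x y) i = nth 0 x i + nth 0 y i.
Proof.
move=> iN; rewrite -(tnth_nth 0 _ (Ordinal iN)) tnth_mktuple.
by rewrite !(tnth_nth 0).
Qed.

Lemma isoreg_tadd N (x z : N.-tuple R) :
  isoreg N (fun i => nth 0 x i + nth 0 z i) (nth 0 (eta_mono (tadd x z))).
Proof.
by apply: isoreg_ext (isoreg_eta_mono (tadd x z)) => // i iN; rewrite nth_tadd.
Qed.

(* With [u := eta (x + z) - x], optimality against [x] gives [|u|^2 <= <z, u>], and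
   [u] lies in the tangent cone of the monotone cone at [x], a product of
   monotone cones over the blocks of [x]. *)
Lemma loss_le_blocks ls N (x z : N.-tuple R) : sumn ls = N ->
  @monoset R N x -> blockwise (@constf R) ls (nth 0 x) ->
  loss x z <= block_nsq ls z.
Proof.
move=> sN mx bx; have iy := isoreg_tadd x z; have [my _ _ _] := iy.
set y := nth 0 (eta_mono _) in iy my *.
have szz : size z = sumn ls by rewrite size_tuple.
have bu : blockwise (@monof R) ls (fun i => y i - nth 0 x i).
  by apply: (@block_const_mono R) => //; rewrite sN.
have := block_dot szz bu; rewrite sN.
have := isoreg_dot iy mx; have := isoreg_dot0 iy.
have -> : loss x z = \sum_(i < N) (y i - nth 0 x i) ^+ 2.
  by rewrite /loss sqdistE; apply: eq_bigr => i _; rewrite -sqrrN opprB.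
have -> : \sum_(i < N) nth 0 z i * (y i - nth 0 x i) =
    \sum_(i < N) (y i - nth 0 x i) ^+ 2 +
    (\sum_(i < N) (nth 0 x i + nth 0 z i - y i) * y i -
     \sum_(i < N) (nth 0 x i + nth 0 z i - y i) * nth 0 x i).
  rewrite -sumrB -big_split /=; apply: eq_bigr => i _; ring.
lra.
Qed.

Definition staircase N ls (A : R) : N.-tuple R :=
  [tuple A * (stair ls i)%:R | i < N].

Lemma nth_staircase N ls A i : (i < N)%N ->
  nth 0 (staircase N ls A) i = A * (stair ls i)%:R.
Proof. by move=> iN; rewrite -(tnth_nth 0 _ (Ordinal iN)) tnth_mktuple. Qed.

Lemma monoset_staircase N ls A : 0 <= A -> @monoset R N (staircase N ls A).
Proof.
move=> A0 t tN; rewrite !nth_staircase //; last exact: ltnW.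
by rewrite ler_wpM2l // ler_nat stair_leS.
Qed.

Lemma blockwise_ext P ls (x y : nat -> R) :
  (forall n (x y : nat -> R), (forall i, (i < n)%N -> x i = y i) -> P n x -> P n y) ->
  (forall i, (i < sumn ls)%N -> x i = y i) -> blockwise P ls x -> blockwise P ls y.
Proof.
move=> eP; elim: ls x y => [//|l ls ih] x y /= e [Px bx]; split.
  by apply: eP Px => i il; apply: e; rewrite (leq_trans il) ?leq_addr.
by apply: ih bx => i il; rewrite /shift e // ltn_add2l.
Qed.

Lemma staircase_const N ls A : sumn ls = N ->
  blockwise (@constf R) ls (nth 0 (staircase N ls A)).
Proof.
move=> sN; apply: blockwise_ext (stair_const ls A).
  move=> n x y e cx i iln; rewrite -!e ?cx //; exact: leq_ltn_trans iln.
by move=> i; rewrite sN => /(nth_staircase ls A) ->.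
Qed.

Lemma njumps_staircase N ls A : sumn ls = N -> 0 <= A ->
  (njumps (staircase N ls A) <= (size ls).-1)%N.
Proof.
case: N => [|N] sN A0; first by [].
have lt : (stair ls N < size ls)%N by apply: stair_lt; rewrite sN.
have le : (stair ls N <= (size ls).-1)%N.
  by rewrite -ltnS prednK // (leq_ltn_trans _ lt).
apply: leq_trans le; apply: leq_trans (stair_jumps ls N); rewrite /njumps /=.
rewrite -!sum1_count big_seq_cond [leqRHS]big_seq_cond.
rewrite big_mkcond [leqRHS]big_mkcond; apply: leq_sum => t _.
case: ifP => // /andP[]; rewrite mem_iota /= add0n => tN.
rewrite !nth_staircase //; last by rewrite ltnW.
move=> lt'; rewrite tN /=.
case: (ltnP (stair ls t) (stair ls t.+1)) => // h.
by move: lt'; rewrite ltNge ler_wpM2l // ler_nat.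
Qed.

(** Once the steps exceed the oscillation of the blockwise regression, adding that regression to the
    staircase gives a monotone signal, so the bound of [loss_le_blocks] is attained at finite
    height. *)
Lemma loss_staircase N ls (z : N.-tuple R) A : sumn ls = N ->
  2 * \sum_(i < N) `|nth 0 (block_etas ls z) i| <= A ->
  loss (staircase N ls A) z = block_nsq ls z.
Proof.
set p := nth 0 (block_etas ls z); set x := staircase N ls A => sN hA.
have A0 : 0 <= A by apply: le_trans hA; rewrite mulr_ge0 ?sumr_ge0.
have szz : size z = sumn ls by rewrite size_tuple.
have mx : @monoset R N x by exact: monoset_staircase.
have iy := isoreg_tadd x z; have [my _ _ _] := iy.
set y := nth 0 (eta_mono _) in iy my *.
pose w i := nth 0 x i + p i.
have pA i j : (i < N)%N -> (j < N)%N -> p i - p j <= A.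
  have ple k : (k < N)%N -> `|p k| <= \sum_(i < N) `|p i|.
    by move=> kN; rewrite (bigD1 (Ordinal kN)) //= lerDl sumr_ge0.
  move=> iN jN; have := ple i iN; have := ple j jN.
  have := ler_norm (p i - p j); have := ler_normB (p i) (p j); lra.
have mw : monof N w.
  move=> t tN; have tN' := ltnW tN; rewrite /w !nth_staircase //.
  have := stair_leS ls t; rewrite leq_eqVlt => /orP[/eqP e|lt].
    by rewrite -e lerD2l; apply: block_etas_mono => //; rewrite sN.
  have : A * (stair ls t)%:R + A <= A * (stair ls t.+1)%:R.
    by rewrite -[X in _ + X]mulr1 -mulrDr natr1 ler_wpM2l // ler_nat.
  by have := pA _ _ tN' tN; lra.
have bu : blockwise (@monof R) ls (fun i => y i - nth 0 x i).
  by apply: block_const_mono; [exact: staircase_const|rewrite sN].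
(* [w] is monotone and is optimal in the larger class of signals whose difference with [x] is
   monotone on each block, to which [y] belongs; Pythagoras at [w] leaves no room between them. *)
have yw i : (i < N)%N -> y i = w i.
  move=> iN; apply/eqP; rewrite -subr_eq0; apply/eqP.
  apply: (@sum_sqr_eq0 _ N (fun j => y j - w j)) => //.
  have := isoreg_pythagoras iy mw; have := block_etas_min szz bu.
  rewrite sN -/p.
  have -> : \sum_(i < N) (nth 0 x i + nth 0 z i - w i) ^+ 2 =
      \sum_(i < N) (nth 0 z i - p i) ^+ 2.
    by apply: eq_bigr => j _; rewrite /w; congr (_ ^+ 2); ring.
  have -> : \sum_(i < N) (nth 0 z i - (y i - nth 0 x i)) ^+ 2 =
      \sum_(i < N) (nth 0 x i + nth 0 z i - y i) ^+ 2.
    by apply: eq_bigr => j _; congr (_ ^+ 2); ring.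
  lra.
rewrite /loss sqdistE -(block_nsqE szz) sN; apply: eq_bigr => i _.
by rewrite -/y yw // /w -sqrrN opprB addrC addKr.
Qed.

End RiskBounds.

(** * Worst-case risk *)

Section WorstCaseRisk.
Variable R : realType.
Implicit Types (ls : seq nat) (N : nat).

Definition risk_at N (x : N.-tuple R) : \bar R :=
  gaussE (fun z : N.-tuple R => (loss x z)%:E).

Lemma loss_ge0 N (x z : N.-tuple R) : 0 <= loss x z.
Proof. by apply: sumr_ge0 => i _; exact: sqr_ge0. Qed.

Lemma measurable_loss N :
  measurable_fun setT (fun p : N.-tuple R * N.-tuple R => loss p.1 p.2).
Proof.
have m1 i : measurable_fun setT (fun p : N.-tuple R * N.-tuple R => nth 0 p.1 i).
  exact: (measurableT_comp (@measurable_nth R N i) measurable_fst).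
have m2 i : measurable_fun setT (fun p : N.-tuple R * N.-tuple R => nth 0 p.2 i).
  exact: (measurableT_comp (@measurable_nth R N i) measurable_snd).
have mt : measurable_fun setT (fun p : N.-tuple R * N.-tuple R => tadd p.1 p.2).
  apply: measurable_tuple => i iN; under eq_fun do rewrite nth_tadd //.
  exact: measurable_funD.
rewrite /loss; under eq_fun do rewrite sqdistE.
apply: measurable_sum => i; apply: measurable_funX; apply: measurable_funB => //.
exact: (measurableT_comp (@measurable_eta_mono R N i) mt).
Qed.

Lemma measurable_loss_at N (x : N.-tuple R) :
  measurable_fun setT (fun z : N.-tuple R => (loss x z)%:E).
Proof.
apply/measurable_EFinP.
exact: (measurableT_comp (@measurable_loss N) (@pair1_measurable _ _ _ _ x)).
Qed.

Lemma measurable_risk_at N : measurable_fun setT (@risk_at N).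
Proof.
apply: (@measurable_gaussE R _ _ N (fun x z => (loss x z)%:E)).
  by move=> x z; rewrite lee_fin loss_ge0.
by apply/measurable_EFinP; exact: measurable_loss.
Qed.

Lemma risk_at_ge0 N (x : N.-tuple R) : (0 <= risk_at x)%E.
Proof. by apply: gaussE_ge0 => z; rewrite lee_fin loss_ge0. Qed.

Lemma block_nsq_ge0 ls (z : seq R) : 0 <= block_nsq ls z.
Proof. by elim: ls z => //= l ls ih z; rewrite addr_ge0 ?nsq_ge0. Qed.

Lemma measurable_block_nsq d (T : measurableType d) ls (h : T -> seq R) :
  (forall x, size (h x) = sumn ls) ->
  (forall i, measurable_fun setT (fun x => nth 0 (h x) i)) ->
  measurable_fun setT (fun x => block_nsq ls (h x)).
Proof.
elim: ls h => [|l ls ih] h hs mh /=; first exact: measurable_cst.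
apply: measurable_funD.
  apply: (@measurable_nsq R _ _ l) => [x|i].
    by rewrite size_takel // hs leq_addr.
  have [il|li] := ltnP i l.
    by under eq_fun do rewrite nth_take //; exact: mh.
  under eq_fun do rewrite nth_default ?size_take_min ?geq_min ?li //.
  exact: measurable_cst.
apply: ih => [x|i]; first by rewrite size_drop hs addKn.
by under eq_fun do rewrite nth_drop; exact: mh.
Qed.

Lemma measurable_block_nsq_tuple ls N : sumn ls = N ->
  measurable_fun setT (fun t : N.-tuple R => (block_nsq ls t)%:E).
Proof.
move=> sN; apply/measurable_EFinP; apply: measurable_block_nsq => [t|i].
  by rewrite size_tuple.
exact: measurable_nth.
Qed.

Lemma gaussE_block_nsq ls N : sumn ls = N ->
  gaussE (fun t : N.-tuple R => (block_nsq ls t)%:E) = (\sum_(l <- ls) harm R l)%:E.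
Proof.
move=> <-; elim: ls => [|l ls ih] /=; first by rewrite big_nil.
have m1 : measurable_fun setT
    (fun t : (l + sumn ls).-tuple R => (nsq (take l t))%:E).
  apply/measurable_EFinP; apply: (@measurable_nsq R _ _ l) => [x|i].
    by rewrite size_takel // size_tuple leq_addr.
  have [il|li] := ltnP i l.
    by under eq_fun do rewrite nth_take //; exact: measurable_nth.
  under eq_fun do rewrite nth_default ?size_take_min ?geq_min ?li //.
  exact: measurable_cst.
have m2 : measurable_fun setT
    (fun t : (l + sumn ls).-tuple R => (block_nsq ls (drop l t))%:E).
  apply/measurable_EFinP; apply: measurable_block_nsq => [x|i].
    by rewrite size_drop size_tuple addKn.
  by under eq_fun do rewrite nth_drop; exact: measurable_nth.
under eq_fun do rewrite EFinD.
rewrite gaussED //; last 2 first.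
- by move=> t; rewrite lee_fin nsq_ge0.
- by move=> t; rewrite lee_fin block_nsq_ge0.
rewrite (@gaussE_take R l (sumn ls) (fun s => (nsq s)%:E)) -rmonoE rmono_harm.
by rewrite (@gaussE_drop R l (sumn ls) (fun s => (block_nsq ls s)%:E)) ih big_cons.
Qed.

(** An affine majorant of [harm] turns the sum over blocks into a function of their number,
    [njumps x + 1], and total length [N]. The result is affine in the jump count, whose expectation
    is constrained. *)
Lemma risk_at_le N (x : N.-tuple R) (a s : R) : (0 < N)%N -> @monoset R N x ->
  (forall l, harm R l <= a + s * l%:R) ->
  (risk_at x <= (a * (njumps x)%:R + (a + s * N%:R))%:E)%E.
Proof.
case: N x => [//|N] x _ mx hl.
have [ls [sN _ bx szls]] := blocks_exist mx.
apply: (@le_trans _ _ (\sum_(l <- ls) harm R l)%:E).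
  rewrite -(gaussE_block_nsq sN); apply: gaussE_le.
  - by move=> z; rewrite lee_fin loss_ge0.
  - exact: measurable_loss_at.
  - exact: measurable_block_nsq_tuple.
  - by move=> z; rewrite lee_fin; exact: loss_le_blocks.
rewrite lee_fin.
have -> : a * (njumps x)%:R + (a + s * N.+1%:R) = a * (size ls)%:R + s * (sumn ls)%:R.
  by rewrite szls sN -[njumpf _ _]/(njumps x) -[(njumps x).+1%:R]natr1; ring.
elim: (ls) => [|l ls' ih]; first by rewrite big_nil /= !mulr0 addr0.
rewrite big_cons /= -nat1r natrD.
have := hl l; have := ih; lra.
Qed.

Lemma measurable_njumps N :
  measurable_fun setT (fun x : N.-tuple R => ((njumps x)%:R : R)%:E).
Proof.
apply/measurable_EFinP; rewrite /njumps.
under eq_fun do rewrite -sum1_count natr_sum big_mkcond /=.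
apply: measurable_sum => t; apply: measurable_fun_ifT => //.
by apply: measurable_fun_ltr; exact: measurable_nth.
Qed.

Lemma measurable_monoset N : measurable (@monoset R N).
Proof.
rewrite (_ : @monoset R N = \bigcap_(t in [set t | (t.+1 < N)%N])
    [set x : N.-tuple R | nth 0 x t <= nth 0 x t.+1]); last first.
  by apply/seteqP; split.
apply: bigcap_measurableType => t _; rewrite -[X in measurable X]setTI.
have := @measurable_fun_ler _ _ _ setT _ _ (@measurable_nth R N t) (@measurable_nth R N t.+1).
by move=> /(_ measurableT [set true] I).
Qed.

Lemma Mmono_le N (eps a s : R) : (0 < N)%N -> 0 <= a -> 0 <= s ->
  (forall l, harm R l <= a + s * l%:R) ->
  (Mmono N eps <= (eps * a + s + a / N%:R)%:E)%E.
Proof.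
move=> N0 a0 s0 hl; have N0' : 0 < N%:R :> R by rewrite ltr0n.
rewrite /Mmono lee_pdivrMl // -EFinM; apply: ge_ereal_sup => _ [nu [nu0 [nuJ ->]]].
rewrite /risk -/(@risk_at N).
apply: (@le_trans _ _ (\int[nu]_x (a%:E * ((njumps x)%:R)%:E + (a + s * N%:R)%:E))%E).
  (* The pointwise bound holds on monotone signals only, which carry the whole mass of [nu]. *)
  apply: ae_ge0_le_integral => //.
  - by move=> x _; exact: risk_at_ge0.
  - exact: measurable_risk_at.
  - by move=> x _; rewrite -EFinM -EFinD lee_fin !addr_ge0 ?mulr_ge0.
  - apply: emeasurable_funD => //; apply: measurable_funeM; exact: measurable_njumps.
  - exists (~` @monoset R N); split=> //.
      by apply: measurableC; exact: measurable_monoset.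
    move=> x /= h mx; apply: h => _.
    by rewrite -EFinM -EFinD; exact: risk_at_le.
rewrite ge0_integralD //=; last 3 first.
- by move=> x _; rewrite mule_ge0 ?lee_fin.
- by apply: measurable_funeM; exact: measurable_njumps.
- by move=> x _; rewrite lee_fin addr_ge0 ?mulr_ge0.
rewrite ge0_integralZl //; last exact: measurable_njumps.
rewrite (integral_cst_probability nu).
apply: (@le_trans _ _ (a%:E * (N%:R * eps)%:E + (a + s * N%:R)%:E)%E).
  by rewrite leeD2r // lee_wpmul2l.
rewrite -EFinM -EFinD lee_fin le_eqVlt; apply/orP; left; apply/eqP.
by field; rewrite lt0r_neq0.
Qed.

Lemma risk_dirac N (x : N.-tuple R) : risk (dirac x) = risk_at x.
Proof.
rewrite /risk integral_dirac //; last exact: measurable_risk_at.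
by rewrite diracT mul1e.
Qed.

Lemma Mmono_ge N ls (eps : R) : (0 < N)%N -> sumn ls = N ->
  ((size ls).-1)%:R <= N%:R * eps ->
  (((\sum_(l <- ls) harm R l) / N%:R)%:E <= Mmono N eps)%E.
Proof.
move=> N0 sN hJ; have N0' : 0 < N%:R :> R by rewrite ltr0n.
rewrite /Mmono lee_pdivlMl // -EFinM mulrC divfK ?lt0r_neq0 //.
set S := ereal_sup _.
pose x (k : nat) := staircase N ls (k%:R : R).
have xS k : (risk_at (x k) <= S)%E.
  apply: ereal_sup_ubound; exists (dirac (x k)); split.
    rewrite /= /dirac indicE memNset // => h; apply: h; exact: monoset_staircase.
  split; last by rewrite risk_dirac.
  rewrite integral_dirac //; last exact: measurable_njumps.
  rewrite diracT mul1e lee_fin; apply: le_trans hJ.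
  by rewrite ler_nat; exact: njumps_staircase.
have [P hP] := gaussE_integral R N.
have mB := measurable_block_nsq_tuple sN.
have B0 (t : N.-tuple R) : (0 <= (block_nsq ls t)%:E)%E by rewrite lee_fin block_nsq_ge0.
have IB := gaussE_block_nsq sN; rewrite hP // in IB.
have cv : (\int[P]_t (loss (x k) t)%:E)%E @[k --> \oo] -->
    (\int[P]_t (block_nsq ls t)%:E)%E.
  apply: (@dominated_cvg _ _ _ P setT measurableT
    (fun k t => (loss (x k) t)%:E) _ (fun t => (block_nsq ls t)%:E)) => //.
  - by move=> k; exact: measurable_loss_at.
  - move=> t _; apply: cvg_near_cst.
    near=> k; congr (_%:E); apply: loss_staircase => //.
    near: k; exact: nbhs_infty_ger.
  - apply/integrableP; split=> //.
    under eq_integral do rewrite gee0_abs //.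
    by rewrite IB ltry.
  - move=> k t _; rewrite gee0_abs ?lee_fin ?loss_ge0 //.
    apply: loss_le_blocks => //; first exact: monoset_staircase.
    exact: staircase_const.
rewrite -IB -(cvg_lim _ cv) //; apply: lime_le; first by apply/cvg_ex; eexists; exact: cv.
near=> k; rewrite -hP; first exact: xS.
- by move=> t; rewrite lee_fin loss_ge0.
- exact: measurable_loss_at.
Unshelve. all: by end_near. Qed.

End WorstCaseRisk.

(** * The limit *)

Section Limit.
Variable R : realType.
Implicit Types (n m l N : nat) (eps : R).

Lemma harm_ge0 n : 0 <= harm R n.
Proof. by apply: sumr_ge0. Qed.

Lemma harm_le m n : (m <= n)%N -> harm R m <= harm R n.
Proof.
move=> /subnKC <-; elim: (n - m)%N => [|k ih]; first by rewrite addn0.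
by rewrite addnS harmS (le_trans ih) // lerDl.
Qed.

(** Increments of [harm] decrease: they are at most [n.+1%:R^-1] to the right of [n] and at least
    that to the left. *)
Lemma harm_le_chord n l : harm R l <= harm R n + (l%:R - n%:R) / n.+1%:R.
Proof.
have [nl|/ltnW ln] := leqP n l.
  rewrite -(subnKC nl); elim: (l - n)%N => [|k ih].
    by rewrite addn0 subrr mul0r addr0.
  have le : (n + k).+1%:R^-1 <= n.+1%:R^-1 :> R.
    by rewrite lef_pV2 ?posrE // ler_nat ltnS leq_addr.
  rewrite addnS harmS (le_trans (lerD ih le)) // -[(n + k).+1%:R]natr1.
  by rewrite le_eqVlt; apply/orP; left; apply/eqP; ring.
suff dn k : (k <= n)%N -> harm R (n - k) + k%:R / n.+1%:R <= harm R n.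
  have := dn (n - l)%N (leq_subr _ _); rewrite subKn // natrB // -lerBrDr.
  by rewrite -mulNr opprB.
elim: k => [|k ih] kn; first by rewrite subn0 mul0r addr0.
have e : (n - k)%N = (n - k.+1).+1 by lia.
have := ih (ltnW kn); rewrite e harmS -[k.+1%:R]natr1 mulrDl mul1r.
have : n.+1%:R^-1 <= (n - k.+1).+1%:R^-1 :> R.
  by rewrite lef_pV2 ?posrE // ler_nat ltnS leq_subr.
move: ((n - k.+1).+1%:R^-1) (n.+1%:R^-1) (k%:R / _) => ? ? ?; lra.
Qed.

Definition hull_index eps : nat := Num.truncn eps^-1.

Definition hull_slope eps : R := (hull_index eps).+1%:R^-1.

(** Value at 0 of the line through the points of [harm] at [hull_index eps] and its successor. *)
Definition hull_icpt eps : R :=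
  harm R (hull_index eps) - (hull_index eps)%:R / (hull_index eps).+1%:R.

Definition hull eps : R := hull_icpt eps + hull_slope eps * eps^-1.

Lemma hull_slope_ge0 eps : 0 <= hull_slope eps. Proof. by rewrite /hull_slope. Qed.

Lemma harm_le_affine eps l : harm R l <= hull_icpt eps + hull_slope eps * l%:R.
Proof.
by have := harm_le_chord (hull_index eps) l; congr (_ <= _);
  rewrite /hull_icpt /hull_slope; ring.
Qed.

Lemma hull_icpt_ge0 eps : 0 <= hull_icpt eps.
Proof.
by have := harm_le_affine eps 0; rewrite mulr0 addr0 /harm big_ord0.
Qed.

Section FixedEps.
Variables (eps : R) (eps01 : 0 < eps < 1).
Let e := eps^-1.
Let n := hull_index eps.
(** Fractional part of [1 / eps], the weight of [n.+1] when [e] is written as a mean of [n] and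
    [n.+1]. *)
Let th := e - n%:R.

Let e1 : 1 < e.
Proof. by case/andP: eps01 => e0 elt1; rewrite /e invf_gt1. Qed.

Let eps_gt0 : 0 < eps. Proof. by case/andP: eps01. Qed.

Lemma hull_index_bounds : n%:R <= e < n.+1%:R.
Proof. by apply: truncn_itv; rewrite ltW // (lt_trans _ e1). Qed.

Lemma hull_index_gt0 : (0 < n)%N.
Proof.
rewrite lt0n; apply/eqP => n0; have /andP[_] := hull_index_bounds.
by rewrite n0 => h; have := lt_trans e1 h; rewrite ltxx.
Qed.

Let th_ge0 : 0 <= th.
Proof. by rewrite /th subr_ge0; case/andP: hull_index_bounds. Qed.

Let th_lt1 : th < 1.
Proof. by rewrite /th ltrBlDl natr1; case/andP: hull_index_bounds. Qed.

Lemma hullE : hull eps = (1 - th) * harm R n + th * harm R n.+1.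
Proof.
rewrite /hull /hull_icpt /hull_slope -/n -/e harmS.
have -> : e = th + n%:R by rewrite /th subrK.
ring.
Qed.

(** The chord is itself a concave majorant, and any other is at least the chord between [n] and
    [n.+1] by concavity. *)
Lemma rhat_hull : rhat e = (hull eps)%:E.
Proof.
apply/eqP; rewrite eq_le; apply/andP; split.
  apply: ereal_inf_lbound; exists (fun y => hull_icpt eps + hull_slope eps * y) => //.
  split=> [x y t _ _ _|l _]; last by rewrite rmono_harm lee_fin harm_le_affine.
  rewrite le_eqVlt; apply/orP; left; apply/eqP; ring.
apply: le_ereal_inf_tmp => _ [g [cg gl] <-]; rewrite lee_fin hullE.
have := cg n%:R n.+1%:R (1 - th).
have -> : (1 - th) * n%:R + (1 - (1 - th)) * n.+1%:R = e.
  by rewrite -natr1 /th; ring.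
have := gl n hull_index_gt0; have := gl n.+1 isT; rewrite !rmono_harm !lee_fin => h1 h2 h.
apply: le_trans (h _ _ _); last 3 first.
- by rewrite ler1n hull_index_gt0.
- by rewrite ler1n.
- by rewrite subr_ge0 (ltW th_lt1) gerBl th_ge0.
rewrite (_ : 1 - (1 - th) = th); last by ring.
by rewrite lerD // ler_wpM2l // subr_ge0 ltW.
Qed.

Definition pi_opt (l : nat) : R :=
  if l == n then 1 - th else if l == n.+1 then th else 0.

(** Taken with [c] equal to 1, to [l] and to [harm l], this gives the mass, the mean and the value
    of [pi_opt]. *)
Lemma pi_opt_sum (c : nat -> R) : (forall l, 0 <= c l) ->
  (\sum_(1 <= l <oo) (c l * pi_opt l)%:E =
   ((1 - th) * c n + th * c n.+1)%:E)%E.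
Proof.
move=> c0; have pi0 l : 0 <= pi_opt l.
  rewrite /pi_opt; case: ifP => _; first by rewrite subr_ge0 ltW.
  by case: ifP => _.
rewrite (nneseries_split 1 n.+1); last first.
  by move=> l _; rewrite lee_fin mulr_ge0.
rewrite [X in (_ + X)%E]eseries0 ?adde0; last first.
  move=> l nl _; rewrite /pi_opt.
  have -> : (l == n) = false by apply/negbTE; lia.
  have -> : (l == n.+1) = false by apply/negbTE; lia.
  by rewrite mulr0.
rewrite add1n sumEFin; congr (_%:E).
rewrite big_nat_recr //= big_nat_recr ?hull_index_gt0 //= big_nat_cond big1.
  rewrite /pi_opt eqxx; have -> : (n.+1 == n) = false by apply/negbTE; lia.
  by rewrite eqxx add0r mulrC [c n.+1 * _]mulrC.
move=> l /andP[/andP[_ ln] _]; rewrite /pi_opt.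
have -> : (l == n) = false by apply/negbTE; lia.
have -> : (l == n.+1) = false by apply/negbTE; lia.
by rewrite mulr0.
Qed.

Lemma pi_opt_feasible : feasible_pi eps pi_opt.
Proof.
split.
  rewrite /pi_opt; have -> : (0 == n) = false.
    by apply/negbTE; have := hull_index_gt0; lia.
  by [].
split.
  move=> l; rewrite /pi_opt; case: ifP => _; first by rewrite subr_ge0 ltW.
  by case: ifP => _.
split.
  have := @pi_opt_sum (fun=> 1) (fun=> ler01); rewrite !mulr1 subrK => <-.
  by apply: eq_eseriesr => l _; rewrite mul1r.
rewrite (@pi_opt_sum (fun l => l%:R)) // -/e; congr (_%:E).
by rewrite -natr1 /th; ring.
Qed.

Lemma pi_opt_value : pi_value eps pi_opt = (eps * hull eps)%:E.
Proof.
rewrite /pi_value hullE EFinM; congr (_ * _)%E.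
rewrite -(pi_opt_sum harm_ge0); apply: eq_eseriesr => l _.
by rewrite rmono_harm -EFinM mulrC.
Qed.

(** Under the chord bound only the mass and the mean of [pi] enter, and both are prescribed. *)
Lemma pi_value_le pi : feasible_pi eps pi -> (pi_value eps pi <= (eps * hull eps)%:E)%E.
Proof.
move=> [_ [pi0 [s1 s2]]]; rewrite /pi_value EFinM lee_wpmul2l ?lee_fin ?(ltW eps_gt0) //.
apply: (@le_trans _ _ (\sum_(1 <= l <oo)
    ((hull_icpt eps)%:E * (pi l)%:E + (hull_slope eps)%:E * (l%:R * pi l)%:E))%E).
  apply: lee_nneseries => l _.
    by rewrite rmono_harm -EFinM lee_fin mulr_ge0 ?harm_ge0.
  rewrite rmono_harm -!EFinM -EFinD lee_fin mulrA -mulrDl mulrC ler_wpM2r //.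
  exact: harm_le_affine.
rewrite nneseriesD; last 2 first.
- by move=> l _ _; rewrite mule_ge0 ?lee_fin ?hull_icpt_ge0.
- by move=> l _ _; rewrite mule_ge0 ?lee_fin ?hull_slope_ge0 ?mulr_ge0.
rewrite !nneseriesZl; last 2 first.
- by move=> l _; rewrite lee_fin mulr_ge0.
- by move=> l _; rewrite lee_fin.
by rewrite s1 s2 mule1 -EFinM -EFinD.
Qed.

(** With [K] the integer part of [N * eps], [N] is cut into [K] blocks of lengths [q] and [q.+1].
    Their mean length is at least [1 / eps]; rounding to [K] costs at most one [hull eps]. *)
Lemma balanced_blocks N : 1 <= N%:R * eps -> exists ls,
  [/\ sumn ls = N, ((size ls).-1)%:R <= N%:R * eps &
      (N%:R * eps - 1) * hull eps <= \sum_(l <- ls) harm R l].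
Proof.
move=> Ne1; pose K := Num.truncn (N%:R * eps).
have /andP[Kle Klt] : K%:R <= N%:R * eps < K.+1%:R.
  by apply: truncn_itv; rewrite (le_trans ler01).
have K0 : (0 < K)%N.
  rewrite lt0n; apply/eqP => K0; move: Klt; rewrite K0 => h.
  by have := le_lt_trans Ne1 h; rewrite ltxx.
pose q := (N %/ K)%N; pose r := (N %% K)%N.
have Nqr : N = (q * K + r)%N by rewrite /q /r -divn_eq.
have rK : (r < K)%N by rewrite ltn_mod.
have sumls : \sum_(l <- nseq r q.+1 ++ nseq (K - r) q) harm R l =
    K%:R * harm R q + r%:R / q.+1%:R.
  rewrite big_cat /= !big_nseq !iter_addr !addr0 -[harm R q.+1 *+ r]mulr_natl.
  rewrite -[harm R q *+ _]mulr_natl harmS natrB ?(ltnW rK) //.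
  ring.
have KeN : K%:R * e <= N%:R.
  by rewrite /e ler_pdivrMr.
have nq : (n <= q)%N.
  rewrite leq_divRL // -(ler_nat R) natrM mulrC (le_trans _ KeN) // ler_wpM2l //.
  by case/andP: hull_index_bounds.
have hull0 : 0 <= hull eps.
  rewrite /hull addr_ge0 ?hull_icpt_ge0 // mulr_ge0 ?hull_slope_ge0 //.
  by rewrite invr_ge0 ltW.
exists (nseq r q.+1 ++ nseq (K - r) q); split.
- rewrite sumn_cat !sumn_nseq mulSn -addnA -mulnDr subnKC ?(ltnW rK) //.
  by rewrite addnC -Nqr.
- rewrite size_cat !size_nseq subnKC ?(ltnW rK) // (le_trans _ Kle) // ler_nat.
  exact: leq_pred.
apply: (@le_trans _ _ (K%:R * hull eps)).
  by rewrite ler_wpM2r // lerBlDr natr1 ltW.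
rewrite sumls hullE harmS.
have n1 : 0 <= n.+1%:R^-1 :> R by [].
(* If [q = n], the number [r] of long blocks is at least [K * th]. If [q > n], every block already
   has [harm] at least [harm R n.+1], which exceeds the chord value at [1 / eps]. *)
move: nq; rewrite leq_eqVlt => /orP[/eqP nq|nq].
  rewrite -nq (_ : K%:R * _ = K%:R * harm R n + K%:R * th * n.+1%:R^-1); last by ring.
  rewrite lerD2l ler_wpM2r // /th mulrBr lerBlDr (le_trans KeN) //.
  by rewrite {1}Nqr -nq natrD natrM addrC mulrC.
apply: (@le_trans _ _ (K%:R * harm R q)); last by rewrite lerDl divr_ge0.
rewrite ler_wpM2l // (le_trans _ (harm_le nq)) // harmS.
rewrite [leLHS](_ : _ = harm R n + th * n.+1%:R^-1); last by ring.
by rewrite lerD2l ler_piMl // ltW.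
Qed.

Lemma Mmono_cvg : (fun N => Mmono N eps) @ \oo --> (eps * hull eps)%:E.
Proof.
have cv (c : R) : (eps * hull eps + c * N%:R^-1)%:E @[N --> \oo] --> (eps * hull eps)%:E.
  apply: cvg_EFin; first by near=> N.
  rewrite -[X in _ --> X]addr0; apply: cvgD; first exact: cvg_cst.
  rewrite -[X in _ --> X](mulr0 c); apply: cvgM; first exact: cvg_cst.
  rewrite -cvg_shiftS; exact: cvg_harmonic.
(* The lower error comes from rounding [N * eps] down, the upper one from having one block more than
   jumps. *)
apply: (squeeze_cvge _ (cv (- hull eps)) (cv (hull_icpt eps))).
near=> N.
have N0 : (0 < N)%N by near: N; exact: nbhs_infty_gt.
have N0' : N%:R != 0 :> R by rewrite pnatr_eq0 -lt0n.
have Ne : 1 <= N%:R * eps.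
  rewrite -ler_pdivrMr // mul1r; near: N; exact: nbhs_infty_ger.
have [ls [sN szls hls]] := balanced_blocks Ne.
apply/andP; split.
  apply: le_trans (Mmono_ge N0 sN szls); rewrite lee_fin.
  rewrite ler_pdivlMr ?ltr0n // (le_trans _ hls) // le_eqVlt; apply/orP; left.
  by apply/eqP; field.
have := Mmono_le eps N0 (hull_icpt_ge0 eps) (hull_slope_ge0 eps) (harm_le_affine eps).
move/le_trans; apply; rewrite lee_fin /hull le_eqVlt; apply/orP; left.
by apply/eqP; field; rewrite N0' lt0r_neq0.
Unshelve. all: by end_near. Qed.

End FixedEps.

(** The induction step is [ln (1 - x) <= - x] at [x = n.+2%:R^-1]. *)
Lemma harm_le_ln n : harm R n.+1 <= 1 + ln n.+1%:R.
Proof.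
elim: n => [|n ih]; first by rewrite /harm big_ord1 ln1 addr0 invr1.
rewrite harmS.
have n0 : 0 < n.+1%:R :> R by [].
have n20 : 0 < n.+2%:R :> R by [].
have : ln (n.+1%:R / n.+2%:R) <= - n.+2%:R^-1 :> R.
  have -> : n.+1%:R / n.+2%:R = 1 + (- n.+2%:R^-1) :> R.
    by rewrite -[in LHS](@natr1 R n.+1); field.
  apply: le_ln1Dx; rewrite ltrN2 invf_lt1 // ltr1n //.
rewrite ln_div ?posrE //; move: ih; move: n.+2%:R^-1 => ?; lra.
Qed.

(** The chord rises by at most 1 past [hull_index eps], so [hull eps] is at most [2 + ln eps^-1].
    The threshold [expR (-1)] makes the logarithm at least 1, hence at most its square. *)
Lemma hull_le_ln eps : 0 < eps <= expR (-1) -> hull eps <= 20 * ln eps^-1 ^+ 2.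
Proof.
move=> /andP[e0 ele].
have eps01 : 0 < eps < 1.
  by rewrite e0 (le_lt_trans ele) // expR_lt1 ltrN10.
have l1 : 1 <= ln eps^-1.
  rewrite lnV ?posrE // lerNr -(expRK (-1)) ler_ln ?posrE ?expR_gt0 //.
have [nle nlt] := andP (hull_index_bounds eps01).
have n0 := hull_index_gt0 eps01.
have hn : harm R (hull_index eps) <= 1 + ln eps^-1.
  rewrite -[hull_index eps]prednK // (le_trans (harm_le_ln _)) // lerD2l prednK //.
  by rewrite ler_ln ?posrE ?invr_gt0 // ltr0n.
have : hull eps <= harm R (hull_index eps) + 1.
  rewrite /hull /hull_icpt /hull_slope.
  have : (hull_index eps).+1%:R^-1 * (eps^-1 - (hull_index eps)%:R) <= 1 :> R.
    rewrite mulrC ler_pdivrMr // mul1r (le_trans _ (ltW nlt)) // gerBl.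
    exact: ler0n.
  by move=> h; rewrite (_ : _ + _ = harm R (hull_index eps) +
    (hull_index eps).+1%:R^-1 * (eps^-1 - (hull_index eps)%:R)) ?lerD2l //; ring.
have : ln eps^-1 <= ln eps^-1 ^+ 2 by rewrite expr2 ler_peMl // (le_trans ler01).
lra.
Qed.

End Limit.

Theorem mainTheorem11 (R : realType) :
  (forall eps : R, 0 < eps < 1 ->
     exists L : R,
       ((fun N : nat => Mmono N eps) @ \oo --> L%:E) /\
       ((exists pi : nat -> R, feasible_pi eps pi /\ pi_value eps pi = L%:E) /\
        (forall pi : nat -> R, feasible_pi eps pi -> (pi_value eps pi <= L%:E)%E)) /\
       (L / eps)%:E = rhat (eps^-1)) /\
  (exists eps0 : R, 0 < eps0 < 1 /\
     forall eps L : R, 0 < eps <= eps0 ->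
       ((fun N : nat => Mmono N eps) @ \oo --> L%:E) ->
       L <= 20 * eps * (ln (eps^-1)) ^+ 2).
Proof.
split.
  move=> eps eps01; exists (eps * hull eps); split; first exact: Mmono_cvg.
  split.
    split; last by move=> pi; exact: pi_value_le.
    by exists (pi_opt eps); split; [exact: pi_opt_feasible|exact: pi_opt_value].
  rewrite rhat_hull // mulrAC divff ?mul1r //.
  by case/andP: eps01 => e0 _; rewrite lt0r_neq0.
have x01 : 0 < expR (-1 : R) < 1 by rewrite expR_gt0 expR_lt1 ltrN10.
exists (expR (-1)); split=> // eps L /andP[e0 ele] cvL.
have eps01 : 0 < eps < 1.
  by rewrite e0 (le_lt_trans ele) //; case/andP: x01.
have [->] : L%:E = (eps * hull eps)%:E.
  by apply: (cvg_unique _ cvL (Mmono_cvg eps01)).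
rewrite mulrAC [leRHS]mulrC ler_wpM2l ?(ltW e0) //.
by apply: hull_le_ln; rewrite e0.
Qed.
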